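(* Let $G$ be a connected $n$-vertex graph that is not a copy of (i.e. not isomorphic to) any member of $\mathcal{S} = \{P_3, K_3, K_{1,3}, C_6, C_6', C_6''\}$, and let $r = \ell(G)$ be the number of leaves of $G$. Then \[\iota_2(G) \leq \left\lfloor \frac{4n-r}{14} \right\rfloor.\] Moreover, equality holds if $G = B_{n,P_3}'$.
   Context: All graphs are finite and simple; $V(G)$ and $E(G)$ denote the vertex set and edge set of $G$. An $n$-vertex graph is a graph with $|V(G)| = n$; connected graphs have $n \geq 1$. For $n \ge 1$, $[n]=\{1,\dots,n\}$, and $[0]=\emptyset$. For $D \subseteq V(G)$, $N[D]$ denotes the closed neighbourhood of $D$ (the set of vertices in $D$ or adjacent to a vertex in $D$), and $G - X$ denotes the graph obtained from $G$ by deleting the vertices in $X$. ''Contains'' refers to (not necessarily induced) subgraphs. For $k \geq 1$, let $\mathcal{E}_k$ be the set of connected graphs that have at least $k$ edges. A set $D \subseteq V(G)$ is an $\mathcal{E}_k$-isolating set of $G$ if $G - N[D]$ contains no copy of a graph in $\mathcal{E}_k$ as a subgraph. $\iota_k(G)$ denotes the size of a smallest $\mathcal{E}_k$-isolating set of $G$. A leaf of $G$ is a vertex of degree $1$ in $G$; $L(G)$ is the set of leaves of $G$ and $\ell(G)=|L(G)|$. Named graphs: $K_n = ([n], \binom{[n]}{2})$; $P_n = ([n], \{\{i,i+1\} : i \in [n-1]\})$; for $n\ge 3$, $C_n = ([n], E(P_n) \cup \{\{n,1\}\})$; $K_{1,3} = ([4], \{\{1,2\},\{1,3\},\{1,4\}\})$;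 $C_6' = ([7], E(C_6) \cup \{\{1,7\}\})$; $C_6'' = ([7], E(C_6') \cup \{\{3,5\}\})$. The graph $B_{n,P_3}'$: if $n \leq 3$, $B_{n,P_3}' = P_n$. If $n \geq 4$, let $a = \lfloor n/4 \rfloor$ and $b = n - 3a$ (so $a \le b \le a+3$), let $F_1,\dots,F_a$ be copies of $P_3$ such that $P_b, F_1, \dots, F_a$ are pairwise vertex-disjoint, and let $m_i$ be the vertex of degree $2$ of $F_i$. Then $B_{n,P_3}'$ has vertex set $[b] \cup \bigcup_{i=1}^a V(F_i)$ and edge set $E(P_a) \cup \{\{a,j\} : j \in [b]\setminus[a]\} \cup \bigcup_{i=1}^a (E(F_i) \cup \{\{i,m_i\}\})$. *)

(* Defs.v *)
From mathcomp Require Import all_boot boolp.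

Set Implicit Arguments.
Unset Strict Implicit.
Unset Printing Implicit Defensive.

Record sgraph := SGraph {
  vertex :> finType;
  adj : rel vertex;
  adj_sym : symmetric adj;
  adj_irrefl : irreflexive adj
}.

Section Basics.
Variable G : sgraph.

Definition edges : {set {set G}} := [set [set p.1; p.2] | p : G * G & adj p.1 p.2].

Definition connected : bool := (0 < #|G|) && [forall x : G, forall y : G, connect (@adj G) x y].

Definition closed_nbhd (D : {set G}) : {set G} :=
  [set x | (x \in D) || [exists y in D, adj x y]].

Definition leaves : {set G} := [set x | #|[set y | adj x y]| == 1].

Section Delete.
Variable X : {set G}.
Let V : finType := {x : G | x \notin X}.
Let e : rel V := fun x y => adj (val x) (val y).
Fact delete_sym : symmetric e. Proof. by move=> x y; apply: adj_sym. Qed.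
Fact delete_irrefl : irreflexive e. Proof. by move=> x; apply: adj_irrefl. Qed.
Definition delete : sgraph := SGraph delete_sym delete_irrefl.
End Delete.

End Basics.

Definition isomorphic (G H : sgraph) : Prop :=
  exists2 f : G -> H, bijective f & forall x y, adj (f x) (f y) = adj x y.

(* [G] has a (not necessarily induced) subgraph isomorphic to [F]. *)
Definition contains_copy (G F : sgraph) : Prop :=
  exists2 f : F -> G, injective f & forall x y, adj x y -> adj (f x) (f y).

Definition conn_edges_ge (k : nat) (F : sgraph) : Prop :=
  connected F /\ k <= #|edges F|.

Definition isolating (k : nat) (G : sgraph) (D : {set G}) : Prop :=
  forall F : sgraph, conn_edges_ge k F -> ~ contains_copy (delete (closed_nbhd D)) F.

(* [arg min] is meaningful because [[set: G]] is always isolating. *)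
Definition isolation_number (k : nat) (G : sgraph) : nat :=
  #|[arg min_(D < [set: G] | `[< isolating k D >]) #|D| ]|.

Lemma isolating_setT (k : nat) (G : sgraph) : isolating k [set: G].
Proof.
move=> F [/andP[/card_gt0P[x _] _] _] [f _ _].
by have := valP (f x); rewrite !inE.
Qed.

Lemma isolation_numberP (k : nat) (G : sgraph) :
  (exists2 D : {set G}, isolating k D & #|D| = isolation_number k G) /\
  (forall D : {set G}, isolating k D -> isolation_number k G <= #|D|).
Proof.
rewrite /isolation_number; case: arg_minnP => [|D /asboolP iD minD].
  by apply/asboolP; apply: isolating_setT.
by split=> [|D' iD']; [exists D | apply: minD; apply/asboolP].
Qed.

(* [r] need be neither symmetric nor irreflexive: it lists each edge in at
   least one orientation, and loops are dropped. *)
Section OfRel.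
Variables (T : finType) (r : rel T).
Let e : rel T := fun x y => (x != y) && (r x y || r y x).
Fact of_rel_sym : symmetric e.
Proof. by move=> x y; rewrite /e eq_sym orbC. Qed.
Fact of_rel_irrefl : irreflexive e.
Proof. by move=> x; rewrite /e eqxx. Qed.
Definition of_rel : sgraph := SGraph of_rel_sym of_rel_irrefl.
End OfRel.

(* The element [i : 'I_n] stands for the vertex [i.+1] of [{1, ..., n}]; the
   edge lists [s] and [path_edges] use the labels [1, ..., n]. *)
Definition of_edges (n : nat) (s : seq (nat * nat)) : sgraph :=
  @of_rel 'I_n (fun i j => (i.+1, j.+1) \in s).

Definition path_edges (n : nat) : seq (nat * nat) :=
  [seq (i, i.+1) | i <- iota 1 n.-1].

Definition cycle_edges (n : nat) : seq (nat * nat) := (n, 1) :: path_edges n.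

Definition complete_graph (n : nat) : sgraph := @of_rel 'I_n (fun _ _ => true).
Definition path_graph (n : nat) : sgraph := of_edges n (path_edges n).
Definition cycle_graph (n : nat) : sgraph := of_edges n (cycle_edges n).
Definition claw : sgraph := of_edges 4 [:: (1, 2); (1, 3); (1, 4)].
Definition C6' : sgraph := of_edges 7 ((1, 7) :: cycle_edges 6).
Definition C6'' : sgraph := of_edges 7 [:: (3, 5), (1, 7) & cycle_edges 6].

Definition exceptional (G : sgraph) : Prop :=
  isomorphic G (path_graph 3) \/ isomorphic G (complete_graph 3) \/
  isomorphic G claw \/ isomorphic G (cycle_graph 6) \/
  isomorphic G C6' \/ isomorphic G C6''.

(* [inl u] is the vertex [u.+1] of [P_b] and [inr (i, k)] is the vertex [k.+1]
   of the copy [F_(i.+1)] of [P_3], whose vertex of degree 2 has label 2. *)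
Definition BP3_rel (a b : nat) (x y : 'I_b + 'I_a * 'I_3) : bool :=
  match x, y with
  | inl u, inl v =>
      ((u.+1, v.+1) \in path_edges a) || ((u.+1 == a) && (a < v.+1))
  | inl u, inr (i, k) => (u.+1 == i.+1) && (k.+1 == 2)
  | inr (i, k), inr (j, l) => (i == j) && ((k.+1, l.+1) \in path_edges 3)
  | inr _, inl _ => false
  end.

Definition BP3 (n : nat) : sgraph :=
  if n <= 3 then path_graph n
  else let a := n %/ 4 in let b := n - 3 * a in of_rel (@BP3_rel a b).

(* Main.v *)
Require Import Defs.
From mathcomp Require Import all_boot.
From mathcomp Require Import boolp zify.

Set Implicit Arguments.
Unset Strict Implicit.
Unset Printing Implicit Defensive.

(** Removing [N[D]] must leave a graph of maximum degree at most 1, since these are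
    the graphs without a connected subgraph having two edges ([isolating_thin]).
    Give weight 3 to the leaves of the graph and weight 4 to its other vertices.  The
    total weight is [4 n - r], so the bound says that 14 times the isolation number
    is at most the total weight ([weight_bound]).

    The proof studies a minimal counterexample.  A vertex [v] of degree at least 3
    and its neighbours weigh at least 14 together, unless the graph is [K_{1,3}]: so
    [v] pays for its presence in the isolating set, and it remains to isolate the
    components of [G - N[v]].  Leaves of [G] in a component with an edge are leaves of
    that component, so by minimality the weight of a component pays for it too, unless
    the component is exceptional.  Such a component is called bad.  Its weight is too
    small by at most 4 ([bad_deficit]); but as soon as a vertex of it with a neighbour
    outside is dominated, one vertex less isolates it, and its weight exceeds what it
    costs by 10 or more ([bad_linked]).  Balancing these amounts is [account].

    First, a component hanging from one vertex [x] is not bad: [x] would weigh 4 and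
    the component would contribute 10, enough to take [x] ([cut_vertex]).  So each
    bad component of [G - N[v]] is linked to two neighbours of [v].  Next, no
    neighbour of [v] is linked to two bad components, as adding it to [v] would gain
    20 for 14 ([linked_unique]).  The neighbours of [v] linked to bad components are
    therefore distinct and numerous, and comparing their weight with the deficits
    leaves two cases ([weigh_ball]): degree 3 with one bad component, or degree 4
    with two, always with large deficits, which only components on three vertices
    and [C_6] have.

    These cases are eliminated by applying the same comparison at a vertex of the bad
    component.  For a hexagon, this is a vertex next to a neighbour of [v], whose own
    bad component must contain [v] ([hex_reverse]).  The graphs
    [C_6'] and [C_6''] appear when [v] has a leaf and there are seven vertices
    ([seven_vertices]).  Once all degrees are at most 2 the graph is a path or a
    cycle, where cutting creates new leaves or a component hanging from one vertex.

    For equality, in [B'_{n,P_3}] every copy of [P_3] needs its own vertex of the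
    isolating set, which gives [floor (n / 4)], and the ends of these copies are enough
    leaves to bring the upper bound down to that value ([BP3_lower]). *)

(** * Neighbourhoods *)

Section Graph.
Variable G : sgraph.
Implicit Types (x y z v : G) (A C D W X Y : {set G}).

Definition nbr x : {set G} := [set y | adj x y].
Definition ball v : {set G} := closed_nbhd [set v].

Lemma in_nbr x y : (y \in nbr x) = adj x y. Proof. by rewrite inE. Qed.

Lemma in_closed D x : (x \in closed_nbhd D) = (x \in D) || [exists y in D, adj x y].
Proof. by rewrite inE. Qed.

Lemma in_ball v x : (x \in ball v) = (x == v) || adj v x.
Proof.
rewrite in_closed inE; congr (_ || _); apply/existsP/idP => [[y]|vx].
  by rewrite inE adj_sym => /andP[/eqP->].
by exists v; rewrite inE eqxx adj_sym.
Qed.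

Lemma ballE v : ball v = v |: nbr v.
Proof. by apply/setP => x; rewrite in_ball !inE. Qed.

Lemma card_ball v : #|ball v| = #|nbr v|.+1.
Proof. by rewrite ballE cardsU1 inE adj_irrefl. Qed.

Lemma ball_closed D v : v \in D -> ball v \subset closed_nbhd D.
Proof.
move=> vD; apply/subsetP => x; rewrite in_ball in_closed => /orP[/eqP->|vx].
  by rewrite vD.
by apply/orP; right; apply/existsP; exists v; rewrite vD adj_sym.
Qed.

Lemma closedP D x :
  reflect (exists2 v, v \in D & x \in ball v) (x \in closed_nbhd D).
Proof.
apply: (iffP idP) => [|[v vD]]; last exact/subsetP/ball_closed.
rewrite in_closed => /orP[xD|/existsP[v /andP[vD xv]]].
  by exists x; rewrite // in_ball eqxx.
by exists v; rewrite // in_ball adj_sym xv orbT.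
Qed.

Lemma closed_nbhdS D D' : D \subset D' -> closed_nbhd D \subset closed_nbhd D'.
Proof.
move=> sDD; apply/subsetP => x /closedP[v vD xv]; apply/closedP; exists v => //.
exact: (subsetP sDD).
Qed.

Lemma sub_closed D : D \subset closed_nbhd D.
Proof. by apply/subsetP => x xD; rewrite in_closed xD. Qed.

Lemma closed_nbhd0 : closed_nbhd set0 = set0 :> {set G}.
Proof.
by apply/setP => x; rewrite in_set0; apply/negbTE/negP => /closedP[v]; rewrite inE.
Qed.

(** * Isolation inside a set of vertices *)

Definition thin A : bool :=
  [forall x in A, forall y in A, forall z in A, adj x y && adj x z ==> (y == z)].

Lemma thinP A :
  reflect (forall x y z, x \in A -> y \in A -> z \in A ->
             adj x y -> adj x z -> y = z) (thin A).
Proof.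
apply: (iffP idP) => [tA x y z xA yA zA xy xz|tA].
  have /forall_inP/(_ _ xA)/forall_inP/(_ _ yA)/forall_inP/(_ _ zA) := tA.
  by rewrite xy xz => /eqP.
apply/forall_inP => x xA; apply/forall_inP => y yA; apply/forall_inP => z zA.
by apply/implyP => /andP[xy xz]; apply/eqP; apply: (tA x).
Qed.

Lemma thinS A A' : A \subset A' -> thin A' -> thin A.
Proof.
move=> /subsetP sA /thinP tA; apply/thinP => x y z xA yA zA.
by apply: tA; apply: sA.
Qed.

Lemma thin_le2 A : #|A| <= 2 -> thin A.
Proof.
move=> A2; apply/thinP => x y z xA yA zA xy xz; apply/eqP/negPn/negP => yz.
have xny : x != y by apply: contraTneq xy => ->; rewrite adj_irrefl.
have xnz : x != z by apply: contraTneq xz => ->; rewrite adj_irrefl.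
have: [set x; y; z] \subset A.
  by apply/subsetP => u; rewrite !inE => /orP[/orP[]|] /eqP->.
move=> /subset_leq_card; rewrite -setUA cardsU1 cards2 yz !inE negb_or xny xnz.
lia.
Qed.

(** [D] ranges over all vertex sets, not only over subsets of [A]: this makes [iso]
    monotone and lets vertices outside [A] help. *)
Definition iso A := #|[arg min_(D < setT | thin (A :\: closed_nbhd D)) #|D|]|.

Lemma iso_spec A :
  (exists2 D, thin (A :\: closed_nbhd D) & #|D| = iso A) /\
  (forall D, thin (A :\: closed_nbhd D) -> iso A <= #|D|).
Proof.
rewrite /iso; case: arg_minnP => [|D tD minD]; last by split=> //; exists D.
by apply: thin_le2; rewrite (_ : _ :\: _ = set0) ?cards0 //; apply/setP => x; rewrite !inE.
Qed.

Lemma isoP A : exists2 D, thin (A :\: closed_nbhd D) & #|D| = iso A.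
Proof. by case: (iso_spec A). Qed.

Lemma iso_min A D : thin (A :\: closed_nbhd D) -> iso A <= #|D|.
Proof. by case: (iso_spec A) => _; apply. Qed.

Lemma isoS A A' : A \subset A' -> iso A <= iso A'.
Proof.
move=> sA; have [D tD <-] := isoP A'; apply/iso_min/(thinS _ tD).
exact: setSD.
Qed.

Lemma iso_thin A : thin A -> iso A = 0.
Proof.
move=> tA; apply/eqP; rewrite -leqn0 -(cards0 G); apply: iso_min.
by rewrite closed_nbhd0 setD0.
Qed.

Lemma iso_ball A v : thin (A :\: ball v) -> iso A <= 1.
Proof. by move=> tA; rewrite -(cards1 v); apply: iso_min. Qed.

(** * Connected sets and components *)

(** Connectedness is stated as an induction principle (a set that meets [C] and
    is closed under the edges of [C] contains [C]): paths are then never needed. *)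
Definition conn C : bool :=
  (C != set0) &&
  [forall A : {set G}, (A :&: C != set0) ==>
     [forall x in A :&: C, forall y in C, adj x y ==> (y \in A)] ==> (C \subset A)].

Lemma connP C :
  reflect (C != set0 /\ forall A x, x \in A -> x \in C ->
      (forall y z, y \in A -> y \in C -> z \in C -> adj y z -> z \in A) -> C \subset A)
    (conn C).
Proof.
apply: (iffP andP) => -[C0 cC]; split=> //.
  move=> A x xA xC clA; move/forallP/(_ A)/implyP: cC.
  have AC : A :&: C != set0 by apply/set0Pn; exists x; rewrite inE xA.
  move=> /(_ AC)/implyP; apply; apply/forall_inP => y; rewrite inE => /andP[yA yC].
  by apply/forall_inP => z zC; apply/implyP; apply: clA.
apply/forallP => A; apply/implyP => /set0Pn[x]; rewrite inE => /andP[xA xC].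
apply/implyP => clA; apply: (cC A x) => // y z yA yC zC yz.
have yAC : y \in A :&: C by rewrite inE yA.
by move/forall_inP/(_ _ yAC)/forall_inP/(_ _ zC)/implyP: clA; apply.
Qed.

Lemma conn_sub C A x : conn C -> x \in A -> x \in C ->
  (forall y z, y \in A -> y \in C -> z \in C -> adj y z -> z \in A) -> C \subset A.
Proof. by move=> /connP[_]; apply. Qed.

Lemma conn_n0 C : conn C -> exists x, x \in C.
Proof. by case/connP => /set0Pn. Qed.

Lemma conn_exit C A x : conn C -> x \in A -> x \in C -> ~~ (C \subset A) ->
  exists y z, [/\ y \in A, y \in C, z \in C, z \notin A & adj y z].
Proof.
move=> cC xA xC /negP nCA.
have [/exists_inP[y yAC /exists_inP[z zC /andP[zA yz]]]|H] :=
    boolP [exists y in A :&: C, [exists z in C, (z \notin A) && adj y z]].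
  by move: yAC; rewrite inE => /andP[yA yC]; exists y, z.
case: nCA.
apply: (conn_sub cC xA xC) => y z yA yC zC yz; apply/negPn/negP => zA.
case/negP: H; apply/exists_inP; exists y; first by rewrite inE yA.
by apply/exists_inP; exists z => //; rewrite zA.
Qed.

Definition comp W C : bool :=
  [&& conn C, C \subset W &
      [forall x in C, forall y in W, adj x y ==> (y \in C)]].

Lemma compP W C :
  reflect [/\ conn C, C \subset W & forall x y, x \in C -> y \in W -> adj x y -> y \in C]
    (comp W C).
Proof.
apply: (iffP and3P) => -[cC sC clC]; split=> //.
  by move=> x y xC yW; move/forall_inP/(_ _ xC)/forall_inP/(_ _ yW)/implyP: clC.
apply/forall_inP => x xC; apply/forall_inP => y yW; apply/implyP; exact: clC.
Qed.

Definition comps W := [set C | comp W C].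

Lemma comp_absorb W C C' x :
  comp W C -> conn C' -> C' \subset W -> x \in C -> x \in C' -> C' \subset C.
Proof.
move=> /compP[_ _ clC] cC' sC' xC xC'; apply: (conn_sub cC' xC xC').
by move=> y z yC _ zC' yz; apply: (clC y) => //; apply: (subsetP sC').
Qed.

Lemma comp_eq W C C' x : comp W C -> comp W C' -> x \in C -> x \in C' -> C = C'.
Proof.
move=> CC CC' xC xC'; apply/eqP; rewrite eqEsubset.
have [cC sC _] := compP _ _ CC; have [cC' sC' _] := compP _ _ CC'.
by rewrite (comp_absorb CC' cC sC xC' xC) (comp_absorb CC cC' sC' xC xC').
Qed.

Lemma comp_cover W x : x \in W -> exists2 C, comp W C & x \in C.
Proof.
move=> xW; pose e y z := [&& y \in W, z \in W & adj y z].
have in_W y : connect e x y -> y \in W.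
  case/connectP=> p; elim/last_ind: p => [_ -> //|p z _].
  by rewrite rcons_path last_rcons => /andP[_ /and3P[_ zW _]] ->.
exists [set y | connect e x y]; last by rewrite inE connect0.
apply/compP; split.
- apply/connP; split; first by apply/set0Pn; exists x; rewrite inE connect0.
  move=> A y yA; rewrite inE => xy clA; apply/subsetP => z; rewrite inE => xz.
  have symE : connect_sym e.
    by apply: sym_connect_sym => u w; rewrite /e adj_sym andbCA.
  have yz : connect e y z by rewrite (connect_trans _ xz) // symE.
  have clB : closed e [set u | (u \in A) && connect e x u].
    apply: intro_closed => // u w /[dup] uw /and3P[uW wW auw].
    rewrite !inE => /andP[uA xu].
    have xw : connect e x w by apply: (connect_trans xu); apply: connect1.
    by rewrite xw andbT; apply: (clA u); rewrite ?inE.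
  by have := closed_connect clB yz; rewrite !inE yA xy xz !andbT => <-.
- by apply/subsetP => y; rewrite inE; apply: in_W.
move=> y z; rewrite !inE => xy zW yz; apply: (connect_trans xy).
by apply: connect1; rewrite /e (in_W _ xy) zW.
Qed.

Lemma comps_partition W : partition (comps W) W.
Proof.
apply/and3P; split.
- rewrite eqEsubset; apply/andP; split; apply/subsetP => x.
    by case/bigcupP => C; rewrite inE => /compP[_ /subsetP sC _]; apply: sC.
  by case/comp_cover => C CC xC; apply/bigcupP; exists C => //; rewrite inE.
- apply/trivIsetP => C C'; rewrite !inE => CC CC' nCC.
  rewrite -setI_eq0; apply: contraNT nCC => /set0Pn[x]; rewrite inE => /andP[xC xC'].
  by rewrite (comp_eq CC CC' xC xC').
by rewrite inE; apply/negP => /compP[/connP[]]; rewrite eqxx.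
Qed.

(** The union of isolating sets of the components isolates [W], because two adjacent
    vertices of [W] lie in the same component. *)
Lemma iso_comps W X : iso (W :\: X) <= \sum_(C in comps W) iso (C :\: X).
Proof.
pose dom A := [arg min_(D < setT | thin (A :\: closed_nbhd D)) #|D|].
have tdom A : thin (A :\: closed_nbhd (dom A)).
  rewrite /dom; case: arg_minnP => // .
  by apply: thin_le2; rewrite (_ : _ :\: _ = set0) ?cards0 //; apply/setP => x; rewrite !inE.
pose U := \bigcup_(C in comps W) dom (C :\: X).
have cU : #|U| <= \sum_(C in comps W) iso (C :\: X).
  rewrite /U; elim/big_rec2: _ => [|C s A _ le]; first by rewrite cards0.
  by apply: leq_trans (leq_card_setU _ _) _; rewrite leq_add2l.
apply: leq_trans cU; apply: iso_min; apply/thinP => x y z.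
rewrite !in_setD => /and3P[xU xX xW] /and3P[yU yX yW] /and3P[zU zX zW] xy xz.
have [C CC xC] := comp_cover xW; have /compP[_ _ clC] := CC.
have sU : closed_nbhd (dom (C :\: X)) \subset closed_nbhd U.
  by apply: closed_nbhdS; apply: (bigcup_sup C (F := fun C => dom (C :\: X))); rewrite inE.
have out u : u \notin closed_nbhd U -> u \notin closed_nbhd (dom (C :\: X)).
  by apply: contra; apply: subsetP.
have /thinP/(_ x y z) := tdom (C :\: X); rewrite !in_setD !out //= xX yX zX xC.
by rewrite (clC x y) // (clC x z) //; apply.
Qed.

(** * Weights *)

(** The weights of all vertices add up to [4 n - r]; see [wgt_leaves]. *)
Definition wt x := 4 - (#|nbr x| == 1).
Definition wgt A := \sum_(x in A) wt x.

Lemma wt3 x : #|nbr x| = 1 -> wt x = 3.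
Proof. by rewrite /wt => ->. Qed.

Lemma wt4 x : #|nbr x| != 1 -> wt x = 4.
Proof. by rewrite /wt => /negbTE->. Qed.

Lemma wt_ge3 x : 3 <= wt x. Proof. by rewrite /wt; case: eqP. Qed.
Lemma wt_le4 x : wt x <= 4. Proof. by rewrite /wt; case: eqP. Qed.

Lemma wgtU1 x A : x \notin A -> wgt (x |: A) = wt x + wgt A.
Proof. by move=> xA; rewrite /wgt big_setU1. Qed.

Lemma wgt1 x : wgt [set x] = wt x. Proof. by rewrite /wgt big_set1. Qed.
Lemma wgtD A A' : A' \subset A -> wgt A = wgt A' + wgt (A :\: A').
Proof. by move=> sA; rewrite {1}/wgt (big_setID A') (setIidPr sA). Qed.

Lemma wgtS A A' : A' \subset A -> wgt A' <= wgt A.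
Proof. by move=> /wgtD->; apply: leq_addr. Qed.

Lemma wgt_ge3 A : 3 * #|A| <= wgt A.
Proof.
rewrite mulnC -sum_nat_const; apply: leq_sum => x _; exact: wt_ge3.
Qed.

Lemma wgt_le4 A : wgt A <= 4 * #|A|.
Proof.
rewrite mulnC -sum_nat_const; apply: leq_sum => x _; exact: wt_le4.
Qed.

Lemma wgt_comps W : wgt W = \sum_(C in comps W) wgt C.
Proof. exact: set_partition_big (comps_partition W). Qed.

Definition bad C := wgt C < 14 * iso C.
(** Truncated, hence 0 when [C] is not bad. *)
Definition deficit C := 14 * iso C - wgt C.
Definition bads W := [set C in comps W | bad C].

Lemma badsP W C : reflect (comp W C /\ bad C) (C \in bads W).
Proof. by rewrite !inE; apply: andP. Qed.

(** What [D] leaves undominated in [Y] can be forgotten: it has maximum degree at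
    most 1 and cannot join up with what is left outside [Y]. *)
Definition sealed D Y :=
  thin (Y :\: closed_nbhd D) /\
  forall x z, x \in Y -> x \notin closed_nbhd D -> adj x z -> z \in Y.

Lemma iso_sealed D Y : sealed D Y ->
  iso setT <= #|D| + \sum_(C in comps (~: Y)) iso (C :\: closed_nbhd D).
Proof.
case=> tY clY; have [D' tD' cD'] := isoP (~: Y :\: closed_nbhd D).
apply: leq_trans (_ : #|D :|: D'| <= _); last first.
  apply: leq_trans (leq_card_setU _ _) _; rewrite leq_add2l cD'; exact: iso_comps.
apply: iso_min; apply/thinP => x y z; rewrite !in_setD !inE !andbT => xD yD zD.
have out u : u \notin closed_nbhd (D :|: D') ->
    (u \notin closed_nbhd D) && (u \notin closed_nbhd D').
  move=> uD; apply/andP; split; apply: contra uD; apply/subsetP/closed_nbhdS.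
    exact: subsetUl.
  exact: subsetUr.
have [/andP[xD1 xD2] /andP[yD1 yD2] /andP[zD1 zD2]] :
  [/\ (x \notin closed_nbhd D) && (x \notin closed_nbhd D'),
      (y \notin closed_nbhd D) && (y \notin closed_nbhd D') &
      (z \notin closed_nbhd D) && (z \notin closed_nbhd D')].
  by split; apply: out; rewrite in_closed !inE.
move=> xy xz; have [xY|xY] := boolP (x \in Y).
  move/thinP: tY => /(_ x y z); rewrite !in_setD xD1 yD1 zD1 xY.
  by rewrite (clY x y) // (clY x z) //; apply.
have nY u : u \notin closed_nbhd D -> adj x u -> u \in ~: Y.
  by move=> uD xu; rewrite inE; apply: contra xY => uY; apply: (clY u); rewrite // adj_sym.
have xY' : x \in ~: Y by rewrite inE.
have := nY y yD1 xy; have := nY z zD1 xz => zY yY.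
by move/thinP: tD' => /(_ x y z); rewrite !in_setD xD1 xD2 yD1 yD2 zD1 zD2 xY' yY zY; apply.
Qed.

End Graph.

(** * Labelled copies of the exceptional graphs *)

Definition claw_edges := [:: (1, 2); (1, 3); (1, 4)].
Definition hex_edges := cycle_edges 6.
Definition hex'_edges := (1, 7) :: hex_edges.
Definition hex''_edges := [:: (3, 5), (1, 7) & hex_edges].

Definition hexes := [:: (6, hex_edges); (7, hex'_edges); (7, hex''_edges)].

Definition redge (s : seq (nat * nat)) (i j : nat) : bool :=
  (i != j) && (((i.+1, j.+1) \in s) || ((j.+1, i.+1) \in s)).

Section Shapes.
Variable G : sgraph.
Implicit Types (x y z v : G) (A C D W X Y : {set G}).

Definition labels k s C (u : nat -> G) :=
  [/\ forall i j, i < k -> j < k -> u i = u j -> i = j,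
      forall z, (z \in C) <-> (exists2 i, i < k & z = u i) &
      forall i j, i < k -> j < k -> adj (u i) (u j) = redge s i j].

Definition is_copy k s C := exists u, labels k s C u.

(** A connected graph on three vertices is [P_3] or [K_3], which need not be told
    apart. *)
Definition exceptional_set C :=
  [\/ #|C| = 3, is_copy 4 claw_edges C
   | exists2 p, p \in hexes & is_copy p.1 p.2 C].

Lemma labels_in k s C u i : labels k s C u -> i < k -> u i \in C.
Proof. by case=> _ inC _ ik; apply/inC; exists i. Qed.

Lemma labels_card k s C u : labels k s C u -> #|C| = k.
Proof.
case=> inj inC _; rewrite -[RHS]card_ord.
have inju : injective (fun i : 'I_k => u i) by move=> i j /inj/val_inj->.
rewrite -(card_imset _ inju); apply: eq_card => z.
apply/idP/imsetP => [/inC[i ik ->]|[i _ ->]]; first by exists (Ordinal ik).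
by apply/inC; exists i.
Qed.

(** Stated on labels rather than vertices so that, for the concrete edge lists above,
    it is decided by evaluation.  The vertices labelled in [X] are left out. *)
Definition isolates_labels k s (X D : seq nat) : bool :=
  let free i := (i \notin X) && all (fun d => (d != i) && ~~ redge s d i) D in
  let L := filter free (iota 0 k) in
  all (fun i => all (fun j => all (fun l =>
    redge s i j && redge s i l ==> (j == l)) L) L) L.

Lemma labels_iso k s C A u (X D : seq nat) : labels k s C u -> A \subset C ->
  (forall i, i \in X -> u i \notin A) -> all (fun d => d < k) D ->
  isolates_labels k s X D -> iso A <= size D.
Proof.
move=> [inj inC ad] /subsetP sA nX /allP Dk chk.
pose D' := [set z in [seq u d | d <- D]].
apply: leq_trans (_ : #|D'| <= _); last by rewrite cardsE -(size_map u D) card_size.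
apply: iso_min; apply/thinP.
have lab z : z \in A :\: closed_nbhd D' -> exists i,
    [/\ i < k, z = u i & i \in filter (fun i => (i \notin X) &&
         all (fun d => (d != i) && ~~ redge s d i) D) (iota 0 k)].
  rewrite in_setD => /andP[zD zA]; have /inC[i ik zi] := sA _ zA; exists i; split=> //.
  rewrite mem_filter mem_iota add0n ik /= andbT; apply/andP; split.
    by apply: contraL zA => /nX; rewrite zi.
  apply/allP => d dD; have dk := Dk _ dD.
  have uD : u d \in D' by rewrite inE map_f.
  have := subsetP (ball_closed uD) z => /contra/(_ zD); rewrite in_ball zi ad // negb_or.
  by case/andP=> ui ->; rewrite andbT; apply: contraNneq ui => ->.
move=> x y z /lab[i [ik -> iL]] /lab[j [jk -> jL]] /lab[l [lk -> lL]].
rewrite !ad // => ij il.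
have /allP/(_ _ iL)/allP/(_ _ jL)/allP/(_ _ lL) := chk.
by rewrite ij il => /eqP->.
Qed.

Lemma labels_iso0 k s C u (D : seq nat) : labels k s C u -> all (fun d => d < k) D ->
  isolates_labels k s [::] D -> iso C <= size D.
Proof. by move=> L Dk chk; apply: (labels_iso L _ _ Dk chk). Qed.

Lemma labels_iso1 k s C u j (D : seq nat) : labels k s C u -> all (fun d => d < k) D ->
  isolates_labels k s [:: j] D -> iso (C :\ u j) <= size D.
Proof.
move=> L Dk chk; apply: (labels_iso L _ _ Dk chk); first exact: subsetDl.
by move=> i; rewrite inE => /eqP->; rewrite !inE eqxx.
Qed.

Lemma labels_deg2 k s C u i j l : labels k s C u -> i < k -> j < k -> l < k ->
  j != l -> redge s i j -> redge s i l -> 1 < #|nbr (u i)|.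
Proof.
move=> [inj _ ad] ik jk lk jl ij il.
have sN : [set u j; u l] \subset nbr (u i).
  by apply/subsetP => z; rewrite !inE => /orP[]/eqP->; rewrite ad.
apply: leq_trans (subset_leq_card sN); rewrite cards2.
by have [/inj e|//] := eqVneq (u j) (u l); rewrite e ?eqxx in jl.
Qed.

(** The weight of [C] as a graph of its own, in which vertices may become leaves. *)
Definition wgt_in C := \sum_(z in C) (4 - (#|nbr z :&: C| == 1)).

(** A leaf of the graph keeps its only neighbour in a connected set of two or more
    vertices, so it is still a leaf there. *)
Lemma wgt_in_le C : conn C -> 1 < #|C| -> wgt_in C <= wgt C.
Proof.
move=> cC C1; apply: leq_sum => z zC; rewrite /wt.
case: (#|nbr z| =P 1) => [/eqP/cards1P[y Ny]|_]; last by lia.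
suff -> : nbr z :&: C = [set y] by rewrite cards1.
have nCz : ~~ (C \subset [set z]).
  by apply/negP => /subset_leq_card; rewrite cards1 leqNgt C1.
have [a [b [aA _ bC bA ab]]] := conn_exit cC (set11 z) zC nCz.
move: aA ab; rewrite !inE => /eqP->; rewrite -in_nbr Ny inE => /eqP eb.
by rewrite -eb; apply/setP => c; rewrite !inE andb_idr // => /eqP->.
Qed.

End Shapes.

(** * Induced subgraphs *)

Section Transfer.
Variable G : sgraph.
Variable C : {set G}.
Let G' := delete (~: C).

Lemma valC (z : G') : val z \in C.
Proof. by have := valP z; rewrite inE negbK. Qed.

Lemma val_onto (z : G) : z \in C -> exists z' : G', val z' = z.
Proof.
move=> zC; have zP : z \notin ~: C by rewrite inE negbK.
by exists (exist _ z zP).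
Qed.

Lemma card_delete : #|G'| = #|C|.
Proof.
rewrite -cardsT -(card_imset [set: G'] val_inj); apply: eq_card => z.
apply/imsetP/idP => [[z' _ ->]|/val_onto[z' <-]]; [exact: valC|by exists z'].
Qed.

Lemma conn_delete : conn C -> conn [set: G'].
Proof.
move=> cC; apply/connP; split.
  by have [z /val_onto[z' _]] := conn_n0 cC; apply/set0Pn; exists z'.
move=> A x xA _ clA.
have sC : C \subset [set val z | z in A].
  apply: (conn_sub cC (x := val x)); [exact: imset_f|exact: valC|].
  move=> y z /imsetP[y' yA ->] _ /val_onto[z' <-] yz; apply: imset_f.
  exact: (clA y').
apply/subsetP => z _; have /(subsetP sC)/imsetP[z' z'A /val_inj->] := valC z.
by [].
Qed.

Lemma iso_delete : iso C <= iso [set: G'].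
Proof.
have [D tD <-] := isoP [set: G']; rewrite -(card_imset _ val_inj).
apply: iso_min; apply/thinP => x y z.
have out (w : G) : w \in C :\: closed_nbhd [set val d | d in D] ->
    exists2 w' : G', val w' = w & w' \in [set: G'] :\: closed_nbhd D.
  rewrite in_setD => /andP[wD /val_onto[w' ew]]; exists w' => //.
  rewrite in_setD in_setT andbT; apply: contra wD => /closedP[d dD].
  rewrite in_ball => dw; apply/closedP; exists (val d); first exact: imset_f.
  by rewrite in_ball -ew.
move=> /out[x' <- xD] /out[y' <- yD] /out[z' <- zD] xy xz.
by congr val; apply: (thinP _ tD x').
Qed.

Lemma wgt_in_delete : wgt [set: G'] = wgt_in C.
Proof.
have -> : wgt_in C = \sum_(z in [set val w | w in [set: G']]) (4 - (#|nbr z :&: C| == 1)).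
  apply: eq_bigl => z; apply/idP/imsetP => [/val_onto[z' <-]|[z' _ ->]].
    by exists z'.
  exact: valC.
rewrite big_imset /=; last by move=> ? ? _ _ /val_inj.
apply: eq_bigr => z _; rewrite /wt; congr (4 - (_ == 1)).
rewrite -(card_imset _ val_inj); apply: eq_card => w.
rewrite !inE; apply/imsetP/andP => [[w' + ->]|[zw /val_onto[w' ew]]].
  by rewrite inE => zw; split=> //; apply: valC.
by exists w' => //; rewrite inE; rewrite -ew in zw.
Qed.

Lemma is_copy_delete k s : is_copy k s [set: G'] -> is_copy k s C.
Proof.
case=> u [inj inC ad]; exists (fun i => val (u i)); split.
- by move=> i j ik jk /val_inj/inj; apply.
- move=> z; split=> [/val_onto[z' <-]|[i ik ->]]; last exact: valC.
  by have /inC[i ik ->] : z' \in [set: G'] by []; exists i.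
- by move=> i j ik jk; rewrite -ad.
Qed.

Lemma exceptional_delete : exceptional_set [set: G'] -> exceptional_set C.
Proof.
case=> [|/is_copy_delete H|[p pH /is_copy_delete H]]; last by apply: Or33; exists p.
  by rewrite cardsT card_delete; apply: Or31.
exact: Or32.
Qed.

End Transfer.

(** * Three vertices, claws and hexagons *)

Section Pieces.
Variable G : sgraph.
Implicit Types (x y z v : G) (A C D W X Y : {set G}).

Lemma card_gt1 x y A : x \in A -> y \in A -> x != y -> 1 < #|A|.
Proof. by move=> xA yA xy; apply/card_gt1P; exists x, y. Qed.

Lemma labels_wgt k s C u : @labels G k s C u -> wgt C = \sum_(i <- iota 0 k) wt (u i).
Proof.
move=> [inj inC _]; rewrite /wgt -big_enum -(big_map u xpredT (@wt G)) /=.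
apply: perm_big; apply: uniq_perm; rewrite ?enum_uniq //.
  rewrite map_inj_in_uniq ?iota_uniq // => i j; rewrite !mem_iota !add0n => /= ik jk.
  exact: inj.
move=> z; rewrite mem_enum; apply/idP/mapP => [/inC[i ik ->]|[i]].
  by exists i; rewrite // mem_iota.
by rewrite mem_iota add0n => /= ik ->; apply/inC; exists i.
Qed.

Lemma conn3 C : conn C -> #|C| = 3 -> exists a m b,
  [/\ C = [set a; m; b], a != b, adj m a & adj m b].
Proof.
move=> cC C3; have [x xC] := conn_n0 cC.
have nC (A : {set G}) : #|A| <= 2 -> ~~ (C \subset A).
  by move=> A2; apply/negP => /subset_leq_card; rewrite C3 leqNgt ltnS A2.
have /(conn_exit cC (set11 x) xC)[x' [y [+ _ yC yx xy]]] : ~~ (C \subset [set x]).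
  by apply: nC; rewrite cards1.
rewrite !inE in yx * => /eqP ex; rewrite {x'}ex in xy.
have /(conn_exit cC (set21 x y) xC)[t [z [tA _ zC zxy tz]]] : ~~ (C \subset [set x; y]).
  by apply: nC; rewrite cards2; case: (_ != _).
rewrite !inE negb_or in zxy; case/andP: zxy => zx zy.
have eC (a b c : G) : a \in C -> b \in C -> c \in C -> a != b -> b != c -> a != c ->
    C = [set a; b; c].
  move=> aC bC cC' ab bc ac; apply/esym/eqP; rewrite eqEcard C3; apply/andP; split.
    by apply/subsetP => w; rewrite !inE => /orP[/orP[]|] /eqP->.
  by rewrite -setUA cardsU1 cards2 bc !inE negb_or ab ac.
move: tA tz; rewrite !inE => /orP[]/eqP-> tz.
  by exists y, x, z; split; rewrite // 1?eq_sym //; apply: eC; rewrite // eq_sym.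
exists x, y, z; split; rewrite // 1?eq_sym // 1?adj_sym //.
by apply: eC; rewrite // eq_sym.
Qed.

Lemma conn3_nbr C : conn C -> #|C| = 3 -> forall y, y \in C ->
  exists2 z, z \in C & adj y z.
Proof.
move=> cC C3 y yC; have nC : ~~ (C \subset [set y]).
  by apply/negP => /subset_leq_card; rewrite C3 cards1.
have [a [b [aA _ bC _ ab]]] := conn_exit cC (set11 y) yC nC.
by exists b; rewrite // -(set1P aA).
Qed.

Lemma iso3 C : #|C| = 3 -> iso C <= 1.
Proof.
move=> C3; have /card_gt0P[y yC] : 0 < #|C| by rewrite C3.
apply: (@iso_ball _ _ y); apply: thin_le2.
have sC : C :\: ball y \subset C :\ y.
  by apply: setDS; rewrite sub1set in_ball eqxx.
apply: leq_trans (subset_leq_card sC) _.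
by have := cardsD1 y C; rewrite yC C3; lia.
Qed.

Lemma iso3D1 C y : #|C| = 3 -> y \in C -> iso (C :\ y) = 0.
Proof.
move=> C3 yC; apply: iso_thin; apply: thin_le2.
by have := cardsD1 y C; rewrite yC C3; lia.
Qed.

Lemma wgt_path a m b : a != b -> adj m a -> adj m b ->
  @wgt G [set a; m; b] = wt a + 4 + wt b.
Proof.
move=> ab ma mb.
have am : a != m by apply: contraTneq ma => ->; rewrite adj_irrefl.
have mb' : m != b by apply: contraTneq mb => ->; rewrite adj_irrefl.
have m4 : wt m = 4.
  by apply: wt4; rewrite eq_sym neq_ltn (@card_gt1 a b) // inE.
by rewrite -setUA !wgtU1 ?wgt1 ?inE ?negb_or ?am ?m4 // addnA.
Qed.

Lemma wgt3 C : conn C -> #|C| = 3 -> 10 <= wgt C.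
Proof.
move=> cC C3; have [a [m [b [-> ab ma mb]]]] := conn3 cC C3.
by rewrite wgt_path //; have := wt_ge3 a; have := wt_ge3 b; lia.
Qed.

Lemma labels_wt4 k s C u i j l : @labels G k s C u -> i < k -> j < k -> l < k ->
  j != l -> redge s i j -> redge s i l -> wt (u i) = 4.
Proof.
move=> L ik jk lk jl ij il; have := labels_deg2 L ik jk lk jl ij il.
by rewrite ltn_neqAle eq_sym => /andP[/wt4].
Qed.

Lemma claw_wgt C u : labels 4 claw_edges C u ->
  wgt C = 4 + wt (u 1) + wt (u 2) + wt (u 3).
Proof.
move=> L; rewrite (labels_wgt L) /= !big_cons big_nil.
by rewrite (labels_wt4 (i := 0) (j := 1) (l := 2) L) // addn0 !addnA.
Qed.

Lemma hex_wgt p C u : p \in hexes -> @labels G p.1 p.2 C u ->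
  wgt C = 24 + (p.1 == 7) * wt (u 6).
Proof.
move=> pH L; rewrite (labels_wgt L); have w4 := labels_wt4 L; move: pH w4.
rewrite !inE => /or3P[]/eqP-> /= w4; rewrite !big_cons big_nil.
all: rewrite (w4 0 1 5) // (w4 1 0 2) // (w4 2 1 3) // (w4 3 2 4) //.
all: by rewrite (w4 4 3 5) // (w4 5 4 0).
Qed.

(** Two antipodal vertices dominate the cycle. *)
Lemma hex_iso p C u : p \in hexes -> @labels G p.1 p.2 C u -> iso C <= 2.
Proof.
by rewrite !inE => /or3P[]/eqP-> /= L; apply: (labels_iso0 (D := [:: 1; 4]) L).
Qed.

(** The antipode of [u j] dominates the middle of the path that remains of the cycle. *)
Lemma hex_isoD1 p C u j : p \in hexes -> @labels G p.1 p.2 C u -> j < 6 ->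
  iso (C :\ u j) <= 1.
Proof.
move=> pH L j6; apply: (labels_iso1 (D := [:: (j + 3) %% 6]) L).
  by move: pH; rewrite !inE => /or3P[]/eqP-> /=; rewrite andbT; lia.
by move: pH; rewrite !inE => /or3P[]/eqP-> /=;
  case: j j6 => [|[|[|[|[|[|]]]]]].
Qed.

Lemma card3P A : #|A| = 3 -> exists a b c, A = [set a; b; c] /\ uniq [:: a; b; c].
Proof.
move=> A3; have := enum_uniq A; have : size (enum A) = 3 by rewrite -cardE.
have mE z : (z \in A) = (z \in enum A) by rewrite mem_enum.
case: (enum A) mE => [|a [|b [|c []]]] // mE _ u; exists a, b, c; split=> //.
by apply/setP => z; rewrite mE !inE orbA.
Qed.

Lemma redge_sym s i j : redge s i j = redge s j i.
Proof. by rewrite /redge eq_sym orbC. Qed.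

Lemma copy_seq x0 s C (us : seq G) : uniq us -> (forall z, (z \in C) = (z \in us)) ->
  (forall i j, i < j -> j < size us -> adj (nth x0 us i) (nth x0 us j) = redge s i j) ->
  is_copy (size us) s C.
Proof.
move=> uus inC ad; exists (nth x0 us); split.
- by move=> i j ik jk /eqP; rewrite nth_uniq // => /eqP.
- move=> z; rewrite inC; split=> [/(nthP x0)[i ik <-]|[i ik ->]]; first by exists i.
  exact: mem_nth.
move=> i j ik jk; have [ij|ji|->] := ltngtP i j; first exact: ad.
  by rewrite adj_sym ad // redge_sym.
by rewrite adj_irrefl /redge eqxx.
Qed.

Lemma hex_rotate C y : is_copy 6 hex_edges C -> y \in C ->
  exists2 u, @labels G 6 hex_edges C u & u 0 = y.
Proof.
case=> u [inj inC ad] /inC[j j6 ->].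
exists (fun i => u ((i + j) %% 6)); last by rewrite add0n modn_small.
have m6 i : i %% 6 < 6 by rewrite ltn_mod.
split=> [i l i6 l6 /inj e|z|i l i6 l6]; last 1 first.
- rewrite ad //; move: i j l i6 j6 l6.
  by do 3![case=> [|[|[|[|[|[|?]]]]]] //].
- have := e (m6 _) (m6 _) => /eqP; rewrite eqn_modDr !modn_small // => /eqP//.
split=> [/inC[i i6 ->]|[i i6 ->]]; last by apply/inC; exists ((i + j) %% 6).
exists ((i + (6 - j)) %% 6); first exact: m6.
by rewrite modnDml -addnA subnK ?(ltnW j6) // modnDr modn_small.
Qed.

Lemma hex_nonleaf C z : is_copy 6 hex_edges C -> z \in C -> 1 < #|@nbr G z|.
Proof.
move=> hC zC; have [u L <-] := hex_rotate hC zC.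
exact: (labels_deg2 (j := 1) (l := 5) L).
Qed.

Lemma hex_card C : @is_copy G 6 hex_edges C -> #|C| = 6.
Proof. by case=> u /labels_card. Qed.

Lemma wgt_full A : (forall z, z \in A -> 1 < #|nbr z|) -> wgt A = 4 * #|A|.
Proof.
move=> A2; rewrite mulnC -sum_nat_const; apply: eq_bigr => z /A2 z2.
by apply: wt4; rewrite eq_sym ltn_eqF.
Qed.

Lemma thin_isolated z A : (forall w, w \in A -> ~~ adj z w) -> thin (A :\ z) -> thin A.
Proof.
move=> zA /thinP tA; apply/thinP => a b c aA bA cA ab ac.
have [az bz] : a != z /\ b != z.
  split; last by apply: contraNneq (zA _ aA) => <-; rewrite adj_sym.
  by apply: contraNneq (zA _ bA) => <-.
have cz : c != z by apply: contraNneq (zA _ aA) => <-; rewrite adj_sym.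
by apply: (tA a); rewrite // !inE ?az ?bz ?cz.
Qed.

Lemma iso_gt0 A : ~~ thin A -> 0 < iso A.
Proof.
move=> nA; rewrite lt0n; apply: contraNneq nA => A0; have [D tD] := isoP A.
by rewrite A0 => /eqP; rewrite cards_eq0 => /eqP D0; rewrite D0 closed_nbhd0 setD0 in tD.
Qed.

Lemma conn_path a m b : adj m a -> adj m b -> @conn G [set a; m; b].
Proof.
move=> ma mb; apply/connP; split; first by apply/set0Pn; exists a; rewrite !inE eqxx.
have inP z : (z \in [set a; m; b]) -> [\/ z = a, z = m | z = b].
  by rewrite !inE => /orP[/orP[]|]/eqP; [apply: Or31|apply: Or32|apply: Or33].
have [aP mP bP] : [/\ a \in [set a; m; b], m \in [set a; m; b] & b \in [set a; m; b]].
  by rewrite !inE !eqxx !orbT.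
move=> A x xA xP clA; have mA : m \in A.
  by case: (inP _ xP) => ex; move: xA; rewrite ex // => xA;
    [apply: (clA a)|apply: (clA b)]; rewrite // adj_sym.
apply/subsetP => z /inP[]->; rewrite //; [apply: (clA m)|apply: (clA m)] => //.
Qed.

Lemma wgt_leaf A : wgt A < 4 * #|A| -> exists2 b, b \in A & #|nbr b| = 1.
Proof.
move=> lt; have [/exists_inP[b bA /eqP b1]|no] := boolP [exists b in A, #|nbr b| == 1].
  by exists b.
suff : wgt A = 4 * #|A| by move=> e; rewrite e ltnn in lt.
rewrite mulnC -sum_nat_const; apply: eq_bigr => b bA; apply: wt4.
by apply: contra no => b1; apply/exists_inP; exists b.
Qed.

Lemma leaf_only a m z : #|nbr a| = 1 -> adj a m -> adj a z -> z = m :> G.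
Proof.
move=> /eqP/cards1P[w Nw]; rewrite -!in_nbr Nw !inE => /eqP-> /eqP->; by [].
Qed.

Lemma hex_reg C z : is_copy 6 hex_edges C -> z \in C -> #|@nbr G z :&: C| = 2.
Proof.
move=> hC zC; have [u [inj inC ad] <-] := hex_rotate hC zC.
have -> : nbr (u 0) :&: C = [set u 1; u 5]; last first.
  rewrite cards2; have -> // : u 1 != u 5.
  by apply/eqP => e; have := inj 1 5 isT isT e.
apply/setP => w; rewrite !inE; apply/andP/orP => [[uw /inC[i i6 wi]]|].
  move: uw; rewrite wi ad //; case: i i6 {wi} => [|[|[|[|[|[|?]]]]]] // _ _; [left|right]; exact: eqxx.
by case=> /eqP->; rewrite ad //; split=> //; apply/inC; [exists 1|exists 5].
Qed.

Lemma uniq_leq_card (s : seq G) A : uniq s -> {subset s <= A} -> size s <= #|A|.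
Proof. by move=> us sA; rewrite -(card_uniqP us); apply/subset_leq_card/subsetP. Qed.

Lemma set3P a b c z : z \in [set a; b; c] -> [\/ z = a, z = b | z = c :> G].
Proof.
by rewrite !inE => /orP[/orP[]|]/eqP; [apply: Or31|apply: Or32|apply: Or33].
Qed.





Lemma hex_copy x0 C (us : seq G) : size us = 6 -> uniq us ->
  (forall z, (z \in C) = (z \in us)) ->
  (forall i, i < 6 -> nbr (nth x0 us i) =
     [set nth x0 us ((i + 5) %% 6); nth x0 us ((i + 1) %% 6)]) ->
  is_copy 6 hex_edges C.
Proof.
move=> s6 uus inC Nus; rewrite -[X in is_copy X]s6; apply: (copy_seq (x0 := x0) uus inC).
rewrite s6 => i j ij j6; have i6 := ltn_trans ij j6.
rewrite -in_nbr Nus // !inE !nth_uniq ?s6 ?ltn_mod //.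
by move: i j i6 j6 ij; do 2![case=> [|[|[|[|[|[|?]]]]]] //].
Qed.

End Pieces.

(** * Bad components of a minimal counterexample *)

Section Minimal.
Variable G : sgraph.
Implicit Types (x y z v : G) (A C D H W X Y : {set G}).

Hypothesis connG : conn [set: G].
(* Minimality, applied to the induced subgraphs. *)
Hypothesis IH : forall C, C != setT -> conn C -> exceptional_set C \/ 14 * iso C <= wgt_in C.
Hypothesis nexcG : ~ exceptional_set [set: G].
Hypothesis badG : bad [set: G].

Lemma bad_exceptional C : C != setT -> conn C -> bad C -> exceptional_set C.
Proof.
move=> nT cC bC; have [//|le] := IH nT cC; exfalso; move: bC; rewrite /bad ltnNge => /negP; apply.
have [C1|C1] := leqP #|C| 1.
  by rewrite iso_thin // thin_le2 // ltnW.
exact: leq_trans le (wgt_in_le cC C1).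
Qed.

Lemma nbr_gt1 x y z : adj x y -> adj x z -> y != z -> 1 < #|nbr x|.
Proof. by move=> xy xz; apply: card_gt1; rewrite inE. Qed.

(** The extreme values are a path on three vertices ending in two leaves of the graph
    (weight 10 for one vertex) and [C_6] (weight 24 for two). *)
Lemma bad_deficit C : C != setT -> conn C -> bad C -> 14 * iso C <= wgt C + 4.
Proof.
move=> nT cC bC; have [C3|[u L]|[p pH [u L]]] := bad_exceptional nT cC bC.
- by have := iso3 C3; have := wgt3 cC C3; lia.
- have /= i1 := labels_iso0 (D := [:: 0]) L isT isT; rewrite (claw_wgt L).
  by have := wt_ge3 (u 1); have := wt_ge3 (u 2); have := wt_ge3 (u 3); lia.
by have := hex_iso pH L; rewrite (hex_wgt pH L); lia.
Qed.

(** Where a bad component is attached matters.  A leaf of a claw, or the pendant vertex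
    of [C_6'] or [C_6''], is not attached to the outside: otherwise it would weigh 4 and
    the component would pay for itself.  At any other vertex, dominating that vertex
    saves one vertex of the isolating set. *)
Lemma bad_linked C x y : C != setT -> conn C -> bad C -> y \in C -> x \notin C ->
  adj x y -> 14 * iso (C :\ y) + 10 <= wgt C.
Proof.
move=> nT cC bC yC xC xy.
have y4 z : z \in C -> adj y z -> wt y = 4.
  move=> zC yz; apply: wt4; rewrite eq_sym neq_ltn.
  have xz : x != z by apply: contraNneq xC => ->.
  by rewrite (nbr_gt1 (x := y) (y := x) (z := z)) // adj_sym.
have [C3|[u L]|[p pH [u L]]] := bad_exceptional nT cC bC.
- by rewrite iso3D1 //; have := wgt3 cC C3; lia.
- have [inj inC ad] := L; have := claw_wgt L.
  have /= i1 := labels_iso0 (D := [:: 0]) L isT isT.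
  have := wt_ge3 (u 1); have := wt_ge3 (u 2); have := wt_ge3 (u 3).
  have /inC[i i4 yi] := yC; case: i i4 yi => [_ yi|i i4 yi].
    have /= := labels_iso1 (D := [::]) (j := 0) L isT isT; rewrite yi; lia.
  have : wt y = 4.
    by apply: (y4 (u 0)); [apply: (labels_in L)|rewrite yi ad //; case: i i4 {yi} => [|[|[]]]].
  move: bC i1 => + + /[dup] y_4; rewrite /bad => bC i1 _ l3 l2 l1 wC; exfalso.
  suff : 14 <= wgt C by move: bC i1; move: (wgt C) (iso C) => a b; clear; lia.
  rewrite wC; move: y_4 l1 l2 l3; rewrite yi; by case: i i4 {yi} => [|[|[]]] //= _;
    move: (wt (u 1)) (wt (u 2)) (wt (u 3)) => a b c; clear; lia.
have [inj inC ad] := L; have wC := hex_wgt pH L; have i2 := hex_iso pH L.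
have /inC[j jp yj] := yC; have [j6|j6] := ltnP j 6.
  have : 24 <= wgt C by rewrite wC leq_addr.
  by have := hex_isoD1 pH L j6; rewrite yj; move: (iso _) (wgt _) => a b; clear; lia.
exfalso; have [p7 j_6] : p.1 = 7 /\ j = 6.
  by move: pH jp j6; clear; rewrite !inE => /or3P[]/eqP-> /=; lia.
have : wt y = 4.
  apply: (y4 (u 0)); first by apply: (labels_in L); rewrite p7.
  rewrite yj j_6 ad ?p7 //.
  by move: pH p7; rewrite !inE => /or3P[]/eqP->.
by move: bC; rewrite /bad wC p7 yj j_6 /=; lia.
Qed.

Lemma bad_kind C : C != setT -> conn C -> bad C ->
  [\/ #|C| = 3, is_copy 6 hex_edges C | deficit C <= 1].
Proof.
move=> nT cC bC; have [C3|[u L]|[p pH [u L]]] := bad_exceptional nT cC bC.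
- exact: Or31.
- apply: Or33; rewrite /deficit (claw_wgt L).
  have /= i1 := labels_iso0 (D := [:: 0]) L isT isT.
  by have := wt_ge3 (u 1); have := wt_ge3 (u 2); have := wt_ge3 (u 3); lia.
have := hex_wgt pH L; have := hex_iso pH L; have := wt_ge3 (u 6).
rewrite /deficit; move: pH L; rewrite !inE => /or3P[]/eqP-> /= L; last 2 first.
- by move=> *; apply: Or33; lia.
- by move=> *; apply: Or33; lia.
by move=> *; apply: Or32; exists u.
Qed.

Definition touches D C := C :&: closed_nbhd D != set0.

Lemma comp_neqT Y C x : comp (~: Y) C -> x \in Y -> C != setT.
Proof.
case/compP=> _ sC _ xY; apply: contraTneq xY => CT.
by have := subsetP sC x; rewrite CT !inE; apply.
Qed.

(** The balance of a partial isolating set [D] that takes care of [Y]: since the graph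
    is a counterexample, the weight of [Y] and the gain of 10 on every bad component
    touched by [D] do not pay for [D] and for the deficits of the other ones. *)
Lemma account D Y : D \subset Y -> sealed D Y ->
  wgt Y + 10 * #|[set C in bads (~: Y) | touches D C]| <
  14 * #|D| + \sum_(C in bads (~: Y) | ~~ touches D C) deficit C.
Proof.
move=> sDY sealY; have le := iso_sealed sealY.
have := wgt_comps (~: Y); have := wgtD (subsetT Y); rewrite setTD => wT wY.
have per C : C \in comps (~: Y) ->
    14 * iso (C :\: closed_nbhd D) + 10 * (bad C && touches D C) <=
    wgt C + (if bad C && ~~ touches D C then deficit C else 0).
  rewrite inE => CC; have [cC sC _] := compP _ _ CC.
  have mono := isoS (subsetDl C (closed_nbhd D)).
  have [bC|gC] := boolP (bad C) => /=; last by move: gC; rewrite /bad; lia.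
  have [tC|_] /= := boolP (touches D C); last by rewrite /deficit; lia.
  have /set0Pn[y] := tC; rewrite inE => /andP[yC /closedP[d dD]].
  have dY := subsetP sDY _ dD.
  have dC : d \notin C by apply: contraTN dY => /(subsetP sC); rewrite inE.
  rewrite in_ball; case: eqP => [yd|_ /= dy]; first by rewrite -yd yC in dC.
  have sb := bad_linked (comp_neqT CC dY) cC bC yC dC dy.
  suff: iso (C :\: closed_nbhd D) <= iso (C :\ y) by move: sb; clear; lia.
  apply/isoS/setDS; rewrite sub1set; apply/closedP; exists d => //.
  by rewrite in_ball dy orbT.
have : \sum_(C in comps (~: Y)) (14 * iso (C :\: closed_nbhd D) +
      10 * (bad C && touches D C)) <= \sum_(C in comps (~: Y)) (wgt C +
      (if bad C && ~~ touches D C then deficit C else 0)) by apply: leq_sum.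
rewrite big_split [X in _ <= X]big_split.
have dist k (F : {set G} -> nat) : \sum_(C in comps (~: Y)) k * F C =
    k * \sum_(C in comps (~: Y)) F C by rewrite big_distrr.
rewrite /= !dist.
have -> : \sum_(C in comps (~: Y)) nat_of_bool (bad C && touches D C) =
    #|[set C in bads (~: Y) | touches D C]|.
  rewrite -sum1_card [RHS]big_mkcond [LHS]big_mkcond /=; apply: eq_bigr => C _.
  by rewrite !inE -andbA; case: (comp _ _) => //=; case: (_ && _).
have -> : \sum_(C in comps (~: Y)) (if bad C && ~~ touches D C then deficit C else 0) =
    \sum_(C in bads (~: Y) | ~~ touches D C) deficit C.
  rewrite -big_mkcondr; apply: eq_bigl => C.
  by rewrite !inE -!andbA.
rewrite -wY; move: badG; rewrite /bad wT; move: le; clear.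
move: (\sum_(C in comps _) _) #|[set C in _ | _]| (\sum_(C in _ | _) _) => a b c.
by move: #|D| (iso _) (wgt _) (wgt _) => d e f g; lia.
Qed.

Lemma account_le1 D Y : D \subset Y -> sealed D Y -> D != set0 ->
  (forall C C', C \in bads (~: Y) -> C' \in bads (~: Y) ->
     ~~ touches D C -> ~~ touches D C' -> C = C') ->
  wgt Y < 14 * #|D| + 4.
Proof.
move=> sDY sealY /set0Pn[d dD] uniqC; have := account sDY sealY.
suff : \sum_(C in bads (~: Y) | ~~ touches D C) deficit C <= 4 by lia.
have [C /andP[CB tC]|none] := pickP [pred C | (C \in bads (~: Y)) && ~~ touches D C].
  rewrite (big_pred1 C) => [|C']; last first.
    apply/andP/eqP => [[CB' tC']|->]; last by [].
    exact: uniqC.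
  have /badsP[CC bC] := CB; have [cC _ _] := compP _ _ CC.
  have := bad_deficit (comp_neqT CC (subsetP sDY _ dD)) cC bC.
  by rewrite /deficit; clear; lia.
by rewrite big_pred0.
Qed.

Lemma account0 D Y : D \subset Y -> sealed D Y ->
  (forall C, C \in bads (~: Y) -> touches D C) -> wgt Y < 14 * #|D|.
Proof.
move=> sDY sealY allC; have := account sDY sealY; rewrite big_pred0 ?addn0; first by lia.
by move=> C; apply/negbTE/negP => /andP[/allC->].
Qed.

Lemma comp_exit W C : comp W C -> C != setT ->
  exists y z, [/\ y \in C, z \notin C, z \notin W & adj y z].
Proof.
case/compP=> cC sC clC nT; have [y yC] := conn_n0 cC.
have nTC : ~~ ([set: G] \subset C) by rewrite subTset.
have [a [b [aC _ _ bC ab]]] := conn_exit connG yC (in_setT y) nTC.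
by exists a, b; split=> //; apply: contra bC => bW; apply: (clC a).
Qed.

Lemma sealed_ball D Y : Y \subset closed_nbhd D -> sealed D Y.
Proof.
move=> sY; split; last by move=> x z /(subsetP sY)->.
by apply: thin_le2; have /eqP-> : Y :\: closed_nbhd D == set0; rewrite ?cards0 ?setD_eq0.
Qed.

(** Every component of the complement of [x] is attached to [x].  Putting [x] in the
    isolating set costs 14, which [x] itself (weight 4) and one bad component (gain 10)
    pay for. *)
Lemma cut_vertex x C : 1 < #|nbr x| -> C \notin bads (~: [set x]).
Proof.
move=> x2; apply/negP => CB.
have tB C' : C' \in bads (~: [set x]) -> touches [set x] C'.
  case/badsP=> CC' _; have nT := comp_neqT CC' (set11 x).
  have [y [z [yC _ + yz]]] := comp_exit CC' nT; rewrite !inE negbK => /eqP zx.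
  apply/set0Pn; exists y; rewrite inE yC /=; apply: (subsetP (ball_closed (set11 x))).
  by rewrite in_ball adj_sym -zx yz orbT.
have := account (subxx [set x]) (sealed_ball (sub_closed [set x])).
rewrite cards1 wgt1 wt4; last by rewrite eq_sym ltn_eqF.
rewrite big_pred0 => [|C']; last by apply/negbTE/negP => /andP[/tB->].
suff : 0 < #|[set C' in bads (~: [set x]) | touches [set x] C']| by lia.
by apply/card_gt0P; exists C; rewrite inE CB tB.
Qed.

(** If all edges leaving [C] ended in [x], then [C] would be a bad component of the
    complement of [x]. *)
Lemma bad_exit2 Y C x : C \in bads (~: Y) -> x \in Y -> 1 < #|nbr x| ->
  exists y z, [/\ y \in C, z \in Y, z != x & adj y z].
Proof.
case/badsP=> CC bC xY x2; have [cC sC clC] := compP _ _ CC.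
have [/exists_inP[y yC /exists_inP[z zY /andP[zx yz]]]|none] :=
    boolP [exists y in C, [exists z in Y, (z != x) && adj y z]].
  by exists y, z.
have xC : x \notin C by apply: contraTN xY => /(subsetP sC); rewrite inE.
have : C \in bads (~: [set x]).
  apply/badsP; split=> //; apply/compP; split=> //.
    by apply/subsetP => y yC; rewrite !inE; apply: contraNneq xC => <-.
  move=> y z yC; rewrite !inE => zx yz; have [zY|zY] := boolP (z \in Y).
    case/negP: none; apply/exists_inP; exists y => //.
    by apply/exists_inP; exists z; rewrite // zx.
  by apply: (clC y); rewrite ?inE.
by rewrite (negbTE (cut_vertex C x2)).
Qed.

(** * The closed neighbourhood of a vertex of degree at least 3 *)

Definition linked x C := [exists y in C, adj x y].

Lemma linkedP x C : reflect (exists2 y, y \in C & adj x y) (linked x C).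
Proof. exact: exists_inP. Qed.

Definition vbads v := bads (~: ball v).

Lemma vbadsP v C : C \in vbads v ->
  [/\ conn C, C != setT, bad C, v \notin C &
   forall y z, y \in C -> adj y z -> z \in C \/ z \in nbr v].
Proof.
case/badsP=> CC bC; have [cC sC clC] := compP _ _ CC.
have vv : v \in ball v by rewrite in_ball eqxx.
have nv y : y \in C -> y \notin ball v by move/(subsetP sC); rewrite inE.
split=> //; first exact: (comp_neqT CC vv).
  by apply: contraL vv => /nv.
move=> y z yC yz; have [|zb] := boolP (z \in ball v); last first.
  by left; apply: (clC y) yC _ yz; rewrite inE.
rewrite in_ball inE => /orP[/eqP zv|->]; last by right.
by have := nv _ yC; rewrite in_ball -zv adj_sym yz orbT.
Qed.

Lemma vbads_out v C y : C \in vbads v -> y \in C -> y \notin ball v.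
Proof. by case/badsP=> /compP[_ sC _] _ /(subsetP sC); rewrite inE. Qed.

Lemma linked_gt1 v x C : C \in vbads v -> x \in nbr v -> linked x C -> 1 < #|nbr x|.
Proof.
move=> CB xv /linkedP[y yC xy]; rewrite inE adj_sym in xv.
apply: (nbr_gt1 xv xy); apply: contraNneq (vbads_out CB yC) => <-.
by rewrite in_ball eqxx.
Qed.

Lemma bad_linked2 v C : C \in vbads v -> exists x x',
  [/\ x \in nbr v, x' \in nbr v, x != x', linked x C & linked x' C].
Proof.
move=> CB; have [cC nT bC vC exC] := vbadsP CB; have [CC _] := badsP _ _ CB.
have [y [x [yC xC xb yx]]] := comp_exit CC nT.
have [xC'|xv] := exC _ _ yC yx; first by rewrite xC' in xC.
have lx : linked x C by apply/linkedP; exists y; rewrite // adj_sym.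
have x2 := linked_gt1 CB xv lx.
have xb' : x \in ball v by rewrite in_ball -in_nbr xv orbT.
have [y' [x' [yC' xb2 xx yx']]] := bad_exit2 CB xb' x2.
exists x, x'; split=> //; last by apply/linkedP; exists y'; rewrite // adj_sym.
  have [xC'|//] := exC _ _ yC' yx'.
  by have := vbads_out CB xC'; rewrite xb2.
by rewrite eq_sym.
Qed.

Definition branches v := [set x in nbr v | 1 < #|nbr x|].

(** A vertex of degree 3 or more weighs 4, a leaf next to it 3, another neighbour 4. *)
Lemma wgt_ball v : 2 < #|nbr v| -> wgt (ball v) = 4 + 3 * #|nbr v| + #|branches v|.
Proof.
move=> v3; rewrite ballE wgtU1 ?inE ?adj_irrefl // wt4; last by rewrite eq_sym ltn_eqF // ltnW.
rewrite -addnA; congr (_ + _); rewrite /wgt.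
have -> : \sum_(x in nbr v) wt x = \sum_(x in nbr v) (3 + (1 < #|nbr x|)).
  apply: eq_bigr => x; rewrite inE adj_sym => xv; rewrite /wt.
  have : 0 < #|nbr x| by apply/card_gt0P; exists v; rewrite inE.
  by case: #|nbr x| => [|[]].
rewrite big_split /= sum_nat_const mulnC; congr (_ + _).
rewrite -sum1_card [RHS]big_mkcond [LHS]big_mkcond; apply: eq_bigr => x _.
by rewrite !inE; case: (adj v x) => //; case: (1 < _).
Qed.

Definition uncovered v X := [set C in vbads v | [forall x in X, ~~ linked x C]].

Lemma sub_uncovered v X : uncovered v X \subset vbads v.
Proof. by apply/subsetP => C; rewrite inE => /andP[]. Qed.

Lemma account_ball v X : 2 < #|nbr v| -> X \subset nbr v ->
  3 * #|nbr v| + #|branches v| + 10 * (#|vbads v| - #|uncovered v X|) <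
  10 + 14 * #|X| + \sum_(C in uncovered v X) deficit C.
Proof.
move=> v3 /subsetP sX.
have vX : v \notin X by apply/negP => /sX; rewrite inE adj_irrefl.
have tE C : C \in vbads v -> touches (v |: X) C = ~~ [forall x in X, ~~ linked x C].
  move=> CB; apply/set0Pn/forall_inPn => [[y]|[x xX /negPn/linkedP[y yC xy]]].
    rewrite inE => /andP[yC /closedP[x]]; rewrite in_setU1 => /predU1P[->|xX].
      by rewrite (negbTE (vbads_out CB yC)).
    rewrite in_ball => /orP[/eqP yx|xy].
      have := vbads_out CB yC; rewrite in_ball negb_or yx => /andP[_].
      by rewrite -in_nbr sX.
    by exists x => //; rewrite negbK; apply/linkedP; exists y.
  exists y; rewrite inE yC; apply/closedP; exists x; first by rewrite !inE xX orbT.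
  by rewrite in_ball xy orbT.
have sD : v |: X \subset ball v.
  by rewrite subUset sub1set in_ball eqxx /= ballE; apply: subsetU; rewrite orbC; apply/orP; left; apply/subsetP.
have := account sD (sealed_ball (ball_closed (setU11 v X))); rewrite wgt_ball // cardsU1 vX.
have -> : [set C in bads (~: ball v) | touches (v |: X) C] = vbads v :\: uncovered v X.
  apply/setP => C; rewrite in_setD [LHS]in_set [C \in uncovered _ _]in_set -/(vbads v).
  by case CB: (C \in vbads v); rewrite //= andbT tE.
rewrite cardsD (setIidPr (sub_uncovered v X)).
rewrite (eq_bigl (mem (uncovered v X))) => [|C]; last first.
  rewrite /= [RHS]in_set -/(vbads v); case CB: (C \in vbads v) => //=.
  by rewrite tE // negbK.
by move: (\sum_(C in _) _) => a; clear; lia.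
Qed.

Lemma double_count (U : {set {set G}}) X :
  (forall C, C \in U -> 1 < #|[set x in X | linked x C]|) ->
  (forall x, x \in X -> #|[set C in U | linked x C]| <= 1) -> 2 * #|U| <= #|X|.
Proof.
move=> U2 X1.
have [le1 le2] : 2 * #|U| <= \sum_(C in U) \sum_(x in X) linked x C /\
    \sum_(x in X) \sum_(C in U) linked x C <= #|X|.
  have cE (I : finType) (A : {set I}) (p : pred I) :
      \sum_(i in A) p i = #|[set i in A | p i]|.
    rewrite -sum1_card [RHS]big_mkcond [LHS]big_mkcond; apply: eq_bigr => i _.
    by rewrite !inE; case: (i \in A) => //=; case: (p i).
  split; first by rewrite mulnC -sum_nat_const; apply: leq_sum => C CU; rewrite cE U2.
  by rewrite -sum1_card; apply: leq_sum => x xX; rewrite cE; apply: X1.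
by apply: leq_trans le1 _; rewrite exchange_big.
Qed.

Lemma deficit_le4 v C : C \in vbads v -> deficit C <= 4.
Proof.
by case/vbadsP=> cC nT bC _ _; have := bad_deficit nT cC bC; rewrite /deficit; lia.
Qed.

Lemma sum_deficit v (U : {set {set G}}) :
  U \subset vbads v -> \sum_(C in U) deficit C <= 4 * #|U|.
Proof.
move=> /subsetP sU; rewrite mulnC -sum_nat_const; apply: leq_sum => C /sU.
exact: deficit_le4.
Qed.

Lemma linked2_branches v C X : C \in vbads v -> (forall x, x \in X -> ~~ linked x C) ->
  1 < #|[set x in branches v :\: X | linked x C]|.
Proof.
move=> CB nX; have [x [x' [xv xv' xx lx lx']]] := bad_linked2 CB.
have inB z : z \in nbr v -> linked z C -> z \in [set x in branches v :\: X | linked x C].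
  move=> zv lz; rewrite inE lz andbT in_setD [z \in branches v]inE zv (linked_gt1 CB) //.
  by rewrite !andbT; apply: contraL lz => /nX.
exact: card_gt1 (inB _ xv lx) (inB _ xv' lx') xx.
Qed.

(** Adding to [v] a neighbour linked to two bad components pays: it costs 14 and
    gains 10 on each.  Take a set [X] of neighbours that maximises the number of bad
    components covered minus [#|X|]; by maximality, no other neighbour is linked to two
    of those that remain, so each of them has two neighbours of [v] for itself, whose
    weight makes up for its deficit. *)
Lemma linked_unique v x C C' : 2 < #|nbr v| -> C \in vbads v -> C' \in vbads v ->
  x \in nbr v -> linked x C -> linked x C' -> C = C'.
Proof.
move=> v3 CB CB' xv lx lx'; apply/eqP/negPn/negP => nCC.
pose f X := (#|vbads v| - #|uncovered v X|) + (#|branches v| - #|X|).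
have [X [sX maxX]] : exists X : {set G}, X \subset branches v /\
    forall Z : {set G}, Z \subset branches v -> f Z <= f X.
  have [X sX maxX] := arg_maxnP (P := fun X => X \subset branches v) f (sub0set _).
  by exists X.
have ucov (Z : {set G}) : #|uncovered v Z| <= #|vbads v|.
  exact/subset_leq_card/sub_uncovered.
(* Covering two more components by one more vertex increases [f]. *)
have gain (Z : {set G}) z C1 C2 : z \notin Z -> C1 != C2 -> C1 \in uncovered v Z ->
    C2 \in uncovered v Z -> linked z C1 -> linked z C2 ->
    #|uncovered v (z |: Z)| + 2 <= #|uncovered v Z|.
  move=> zZ n12 C1U C2U l1 l2.
  have : [set C1; C2] :|: uncovered v (z |: Z) \subset uncovered v Z.
    apply/subsetP => E; rewrite in_setU => /orP[]; first by rewrite in_set2 => /orP[]/eqP->.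
    rewrite !inE => /andP[-> /forall_inP EZ]; apply/forall_inP => y yZ.
    by apply: EZ; rewrite !inE yZ orbT.
  move/subset_leq_card; rewrite cardsU cards2 n12.
  have -> : [set C1; C2] :&: uncovered v (z |: Z) = set0; last by rewrite cards0; clear; lia.
  apply/setP => E; rewrite !inE; apply/negbTE/negP => /and3P[E12 _ /forall_inP/(_ z)].
  by rewrite !inE eqxx => /(_ isT); case/orP: E12 => /eqP->; rewrite ?l1 ?l2.
have xT : x \in branches v by rewrite inE xv (linked_gt1 CB).
have fx : #|branches v|.+1 <= f X.
  have := maxX [set x]; rewrite sub1set xT => /(_ isT); apply: leq_trans; rewrite /f.
  have u0 : uncovered v set0 = vbads v.
    apply/setP => E; rewrite inE; case: (E \in vbads v) => //=.
    by apply/forall_inP => y; rewrite inE.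
  have := gain set0 x C C'; rewrite inE u0 setU0 => /(_ isT nCC CB CB' lx lx').
  by have : 0 < #|branches v| by [apply/card_gt0P; exists x]; rewrite cards1; clear; lia.
have priv : 2 * #|uncovered v X| <= #|branches v :\: X|.
  apply: double_count => [E|z]; first last.
    rewrite in_setD => /andP[zX zT]; rewrite leqNgt; apply/negP => /card_gt1P[C1 [C2 []]].
    rewrite ![_ \in [set _ in uncovered v X | _]]inE => /andP[C1U l1] /andP[C2U l2] n12.
    have := maxX (z |: X); rewrite subUset sub1set zT sX => /(_ isT).
    have := gain X z C1 C2 zX n12 C1U C2U l1 l2; rewrite /f cardsU1 zX.
    have := ucov X; have := subset_leq_card sX; have : #|z |: X| <= #|branches v|.
      by apply: subset_leq_card; rewrite subUset sub1set zT.
    by rewrite cardsU1 zX; clear; lia.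
  rewrite inE => /andP[EB /forall_inP EX]; apply: linked2_branches => //.
have sTN : branches v \subset nbr v by apply/subsetP => z; rewrite inE => /andP[].
have := account_ball v3 (subset_trans sX sTN); have := sum_deficit (sub_uncovered v X).
move: priv fx (ucov X) (subset_leq_card sX) (subset_leq_card sTN).
rewrite /f cardsD (setIidPr sX).
by move: (\sum_(_ in _) _) #|uncovered v X| #|X| #|branches v| #|vbads v| #|nbr v| => a u k t m d; clear; lia.
Qed.

Lemma uncovered0 v : uncovered v set0 = vbads v.
Proof.
apply/setP => E; rewrite inE; case: (E \in vbads v) => //=.
by apply/forall_inP => y; rewrite inE.
Qed.

Lemma sub_branches v : branches v \subset nbr v.
Proof. by apply/subsetP => z; rewrite inE => /andP[]. Qed.

Lemma conn_full x A : x \in A -> (forall y z, y \in A -> adj y z -> z \in A) -> A = setT.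
Proof.
move=> xA clA; apply/eqP; rewrite -subTset; apply: (conn_sub connG xA) => // y z yA _ _.
exact: clA.
Qed.

(** With [d] neighbours of [v], of which [t] are not leaves, and [m] bad components,
    [account_ball] gives [3 d + t < 10 + 4 m], and [2 m <= t <= d] by
    [linked_unique].  If [m] is 0 then [v] has three neighbours, all leaves, and the
    graph is a claw. *)
Lemma weigh_ball v : 2 < #|nbr v| ->
  (exists H, [/\ #|nbr v| = 3, vbads v = [set H], 1 < #|branches v| &
                 #|branches v| <= deficit H]) \/
  (exists H1 H2, [/\ #|nbr v| = 4, branches v = nbr v, vbads v = [set H1; H2], H1 != H2 &
                 7 <= deficit H1 + deficit H2]).
Proof.
move=> v3; have := account_ball v3 (sub0set _); rewrite uncovered0 cards0.
have := sum_deficit (subxx (vbads v)); have tN := subset_leq_card (sub_branches v).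
have m2 : 2 * #|vbads v| <= #|branches v|.
  apply: double_count => [C CB|x].
    by have := @linked2_branches v C set0 CB; rewrite setD0; apply=> x; rewrite inE.
  rewrite inE => /andP[xv _]; rewrite leqNgt; apply/negP => /card_gt1P[C1 [C2 []]].
  rewrite ![_ \in [set _ in vbads v | _]]inE => /andP[CB1 l1] /andP[CB2 l2] /eqP; apply.
  exact: (linked_unique v3 CB1 CB2 xv l1 l2).
have [/eqP|m0] := posnP #|vbads v|.
  rewrite cards_eq0 => /eqP B0 _; rewrite B0 big_set0 cards0 => le; exfalso.
  have [d3 t0] : #|nbr v| = 3 /\ #|branches v| = 0.
    by move: le tN v3; move: #|nbr v| #|branches v| => d t; clear; lia.
  have nb x : x \in nbr v -> forall y, adj x y -> y = v.
    move=> xv y xy; apply/eqP/negPn/negP => yv.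
    suff : 0 < #|branches v| by rewrite t0.
    apply/card_gt0P; exists x; rewrite inE xv; apply: (nbr_gt1 xy _ yv).
    by rewrite adj_sym -in_nbr.
  have [a [b [c [Nv]]]] := card3P d3; rewrite /= !inE andbT negb_or => /andP[/andP[ab ac] bc].
  have [va [vb vc]] : adj v a /\ adj v b /\ adj v c by rewrite -!in_nbr Nv !inE !eqxx !orbT.
  have vn z : adj v z -> (v == z) = false by move=> vz; apply: contraTF vz => /eqP<-; rewrite adj_irrefl.
  have nn y z : adj v y -> adj v z -> adj y z = false.
    by move=> vy vz; apply/negP => /nb zv; have := vn z vz; rewrite zv ?inE ?eqxx.
  apply: nexcG; apply: Or32; apply: (@copy_seq _ v _ _ [:: v; a; b; c]).
  - by rewrite /= !inE !vn // (negbTE ab) (negbTE ac) (negbTE bc).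
  - have <- : v |: nbr v = setT; last by move=> z; rewrite Nv !inE !orbA.
    apply: (@conn_full v); rewrite ?setU11 // => y z.
    rewrite !inE => /orP[/eqP-> ->|]; first by rewrite orbT.
    by rewrite -in_nbr => /nb yv /yv->; rewrite eqxx.
  move=> i j; case: j => [|[|[|[|j]]]]; case: i => [|[|[|[|i]]]] // _ _; rewrite /nth;
    first [by rewrite ?va ?vb ?vc | by rewrite nn].
have [/eqP/cards1P[H BH]|m1] := eqVneq #|vbads v| 1.
  rewrite BH big_set1 cards1 => leH le; left; exists H.
  move: leH le m2 tN v3; rewrite BH cards1.
  by move: #|nbr v| #|branches v| (deficit H) => d t e; clear; split=> //; lia.
have [/eqP/cards2P[H1 [H2 [nH BH]]]|m2'] := eqVneq #|vbads v| 2.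
  rewrite BH big_setU1 ?inE // big_set1 cards2 nH => leH le; right; exists H1, H2.
  have tE : #|nbr v| <= #|branches v| -> branches v = nbr v.
    by move=> leN; apply/eqP; rewrite eqEcard sub_branches.
  have [d4 e7] : (#|nbr v| = 4 /\ #|nbr v| <= #|branches v|) /\
      7 <= deficit H1 + deficit H2.
    move: leH le m2 tN v3; rewrite BH cards2 nH.
    move: #|nbr v| #|branches v| (deficit H1) (deficit H2) => d t e f.
    by rewrite /=; clear; lia.
  by have [d4' /tE] := d4.
move=> leH le; exfalso; move: leH le m0 m1 m2 m2' tN.
by move: (\sum_(_ in _) _) #|nbr v| #|branches v| #|vbads v| => s d t m; clear; lia.
Qed.

Lemma vbads_exists v : 2 < #|nbr v| -> exists C, C \in vbads v.
Proof.
move=> /weigh_ball[[H [_ -> _ _]]|[H1 [H2 [_ _ -> _ _]]]]; [exists H|exists H1]; exact: setU11 || exact: set11.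
Qed.

Lemma deficit_ge3 v C : 2 < #|nbr v| -> (forall x, x \in nbr v -> 1 < #|nbr x|) ->
  C \in vbads v -> 3 <= deficit C.
Proof.
move=> v3 vN CB; have tE : branches v = nbr v.
  by apply/setP => x; rewrite inE andb_idr //; apply: vN.
case: (weigh_ball v3) => [[H [d3 BH _ leH]]|[H1 [H2 [_ _ BH _ le7]]]].
  by move: CB; rewrite BH inE => /eqP->; move: leH; rewrite tE d3.
have := @deficit_le4 v H1; have := @deficit_le4 v H2; rewrite BH !inE !eqxx orbT.
move=> /(_ isT) l2 /(_ isT) l1; move: CB; rewrite BH !inE => /orP[]/eqP->.
all: by move: l1 l2 le7; move: (deficit H1) (deficit H2) => e f; clear; lia.
Qed.

Lemma vbad_kind v C : C \in vbads v -> 2 <= deficit C ->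
  #|C| = 3 \/ is_copy 6 hex_edges C.
Proof.
case/vbadsP=> cC nT bC _ _ d2; have [C3|hC|d1] := bad_kind nT cC bC; [by left|by right|].
by rewrite leqNgt ltnS d1 in d2.
Qed.

(** The comparison is now made at the vertex [u 0] of a hexagon, next to a neighbour
    [x] of [v].  A bad component [C] outside [N[u 0]] that avoids [v] would lie in the
    hexagon, where the three vertices [u 2], [u 3], [u 4] have deficit only 2, or be
    another bad component at [v], linked like the hexagon to some neighbour of [v]. *)
Lemma hex_reverse v H u x : 2 < #|nbr v| -> H \in vbads v -> labels 6 hex_edges H u ->
  x \in nbr v -> adj x (u 0) ->
  [/\ 2 < #|nbr (u 0)|, forall z, z \in nbr (u 0) -> 1 < #|nbr z| &
   exists C, [/\ C \in vbads (u 0), v \in C & 3 <= deficit C]].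
Proof.
move=> v3 HB L xv xy; have [inj inH ad] := L; set y := u 0 in xy *.
have [cH _ _ vH exH] := vbadsP HB; have [CH _] := badsP _ _ HB.
have hH : is_copy 6 hex_edges H by exists u.
have uH i : i < 6 -> u i \in H := labels_in L.
have yH : y \in H by apply: uH.
have yv : y \notin ball v := vbads_out HB yH.
have y1 : adj y (u 1) by rewrite ad.
have y5 : adj y (u 5) by rewrite ad.
have xH : x \notin H.
  by apply: contraL xv => /(vbads_out HB); rewrite in_ball negb_or -in_nbr => /andP[].
have y3 : 2 < #|nbr y|.
  apply: (@leq_trans #|[set x; u 1; u 5]|); last first.
    by apply/subset_leq_card/subsetP => z; rewrite !inE => /orP[/orP[]|]/eqP->;
      rewrite // adj_sym.
  rewrite -setUA cardsU1 cards2 !inE negb_or.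
  have -> : u 1 != u 5 by apply/eqP => e; have := inj 1 5 isT isT e.
  by rewrite (contraNneq _ xH) ?(contraNneq _ xH) // => ->; apply: uH.
have yN z : z \in nbr y -> 1 < #|nbr z|.
  rewrite inE => yz; have [zH|zv] := exH _ _ yH yz; first exact: hex_nonleaf zH.
  by apply: linked_gt1 HB zv _; apply/linkedP; exists y; rewrite // adj_sym.
split=> //; have [C CB] := vbads_exists y3; have C3 := deficit_ge3 y3 yN CB.
exists C; split=> //; apply/negPn/negP => vC.
have [cC nTC bC yC exC] := vbadsP CB.
have Cv z : z \in C -> z \notin ball v.
  move=> zC; rewrite in_ball; apply/norP; split; first by apply: contraNneq vC => <-.
  apply/negP; rewrite adj_sym => zv; have [vC'|] := exC _ _ zC zv; first by rewrite vC' in vC.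
  by rewrite inE adj_sym => vy; rewrite in_ball vy orbT in yv.
have sC : C \subset ~: ball v by apply/subsetP => z /Cv; rewrite in_setC.
have [/set0Pn[z]|CH0] := boolP (C :&: H != set0).
  rewrite inE => /andP[zC zH]; have sCH := comp_absorb CH cC sC zH zC.
  have C2 : #|C| <= 3.
    apply: (@leq_trans #|[set u 2; u 3; u 4]|); last first.
      by rewrite -setUA cardsU1 cards2; case: (_ \notin _); case: (_ != _).
    apply/subset_leq_card/subsetP => w wC; have := vbads_out CB wC.
    have /inH[i i6 ->] := subsetP sCH _ wC; rewrite in_ball ad // !inE.
    by case: i i6 => [|[|[|[|[|[|?]]]]]] //; rewrite ?eqxx ?orbT.
  have [C3'|/hex_card C6] := vbad_kind CB (ltnW C3); last by rewrite C6 in C2.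
  have wC : wgt C = 12.
    by rewrite wgt_full ?C3' // => w /(subsetP sCH); apply: hex_nonleaf.
  by have := iso3 C3'; move: C3; rewrite /deficit wC; move: (iso C) => i; clear; lia.
have CH1 z : z \in C -> z \notin H.
  by move=> zC; apply: contra CH0 => zH; apply/set0Pn; exists z; rewrite inE zC.
have CvB : C \in vbads v.
  apply/badsP; split=> //; apply/compP; split=> // z w zC; rewrite inE => wv zw.
  have [//|yw] := exC _ _ zC zw; rewrite inE in yw.
  have [wH|] := exH _ _ yH yw; last by rewrite inE => vw; rewrite in_ball vw orbT in wv.
  have wz : adj w z by rewrite adj_sym.
  have [zH|] := exH w z wH wz; first by have := CH1 _ zC; rewrite zH.
  by rewrite inE => vz; have := Cv _ zC; rewrite in_ball vz orbT.
have [x1 [_ [x1y _ _ l1 _]]] := bad_linked2 CB; rewrite inE in x1y.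
have /linkedP[z zC x1z] := l1; have [x1H|x1v] := exH _ _ yH x1y.
  have [zH|] := exH _ _ x1H x1z; first by have := CH1 _ zC; rewrite zH.
  by rewrite inE => vz; have := Cv _ zC; rewrite in_ball vz orbT.
have lH : linked x1 H by apply/linkedP; exists y; rewrite // adj_sym.
have HC := linked_unique v3 HB CvB x1v lH l1.
by have := CH1 _ zC; rewrite HC zC.
Qed.

(** A component [H1] of deficit 4 is a path or a hexagon.  The centre of the path has
    degree at least 4 and a leaf, against [weigh_ball].  In the case of a hexagon, the
    bad component found by [hex_reverse] swallows [H2] and is a hexagon without leaves,
    while [H2] must contain one. *)
Lemma no_degree4 v H1 H2 : #|nbr v| = 4 -> branches v = nbr v ->
  H1 \in vbads v -> H2 \in vbads v -> H1 != H2 -> 4 <= deficit H1 -> 3 <= deficit H2 ->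
  False.
Proof.
move=> v4 bv H1B H2B nH d1 d2; have v3 : 2 < #|nbr v| by rewrite v4.
have [cH1 nTH1 bH1 vH1 exH1] := vbadsP H1B; have [cH2 _ bH2 vH2 exH2] := vbadsP H2B.
have [x [x' [xv xv' xx lx lx']]] := bad_linked2 H1B.
have nout z : z \in nbr v -> z \notin H1.
  by apply: contraL => /(vbads_out H1B); rewrite in_ball negb_or -in_nbr => /andP[].
have nout2 z : z \in nbr v -> z \notin H2.
  by apply: contraL => /(vbads_out H2B); rewrite in_ball negb_or -in_nbr => /andP[].
have [H13|hH1] := vbad_kind H1B (ltnW (ltnW d1)).
  have [a [m [b [HE ab ma mb]]]] := conn3 cH1 H13.
  have [wa wb] : wt a = 3 /\ wt b = 3.
    have := iso3 H13; move: d1 (wt_ge3 a) (wt_ge3 b).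
    rewrite /deficit {2}HE wgt_path //; move: (iso _) (wt a) (wt b) => i p q.
    by clear; lia.
  have leaf z : wt z = 3 -> #|nbr z| = 1 by rewrite /wt; case: eqP.
  have lm z : z \in nbr v -> linked z H1 -> adj z m.
    move=> zv /linkedP[y yH zy]; have := nout _ zv; rewrite HE in yH *.
    move: yH; rewrite !inE => /orP[/orP[]|]/eqP ey; rewrite {y}ey in zy; rewrite //.
      have := @leaf_only _ a m z (leaf _ wa); rewrite adj_sym ma adj_sym zy => /(_ isT isT)->.
      by rewrite eqxx orbT.
    have := @leaf_only _ b m z (leaf _ wb); rewrite adj_sym mb adj_sym zy => /(_ isT isT)->.
    by rewrite eqxx orbT.
  have m4 : 3 < #|nbr m|.
    apply: (@uniq_leq_card _ [:: a; b; x; x']).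
      have [aH bH] : a \in H1 /\ b \in H1 by rewrite HE !inE !eqxx !orbT.
      have nx z w : z \in H1 -> w \in nbr v -> z != w.
        by move=> zH /nout; apply: contraNneq => <-.
      by rewrite /= !inE !negb_or ab xx !nx.
    move=> z; rewrite !inE => /or4P[]/eqP-> //; rewrite adj_sym; exact: lm.
  case: (weigh_ball (ltnW m4)) => [[H [m3]]|[K1 [K2 [_ bm _ _ _]]]]; first by rewrite m3 in m4.
  have : a \in branches m by rewrite bm inE.
  by rewrite inE (leaf _ wa) andbF.
have /linkedP[y yH xy] := lx; have [u L uy] := hex_rotate hH1 yH.
have [y3 yN [C [CB vC d3]]] : [/\ 2 < #|nbr y|, forall z, z \in nbr y -> 1 < #|nbr z| &
   exists C, [/\ C \in vbads y, v \in C & 3 <= deficit C]].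
  by rewrite -uy; apply: (hex_reverse v3 H1B L xv); rewrite uy.
have [cC nTC bC yC exC] := vbadsP CB; have [CC _] := badsP _ _ CB.
have yv : y \notin ball v := vbads_out H1B yH.
have yH2 : y \notin H2.
  by apply: contra nH => yH2; rewrite (comp_eq (badsP _ _ H1B).1 (badsP _ _ H2B).1 yH yH2).
have H2y z : z \in H2 -> z \notin ball y.
  move=> zH; rewrite in_ball negb_or; apply/andP; split; first by apply: contraNneq yH2 => <-.
  apply/negP; rewrite adj_sym => zy; have [yH2'|] := exH2 _ _ zH zy; first by rewrite yH2' in yH2.
  by rewrite inE => vy; rewrite in_ball vy orbT in yv.
have [x3 [x4 [x3v x4v x34 l3 l4]]] := bad_linked2 H2B.
have inC z : z \in nbr v -> linked z H2 -> z \in C.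
  move=> zv lz; have [//|yz] : z \in C \/ z \in nbr y by apply: (exC v); rewrite // -in_nbr.
  have lz1 : linked z H1 by apply/linkedP; exists y; rewrite // adj_sym -in_nbr.
  by rewrite (linked_unique v3 H1B H2B zv lz1 lz) eqxx in nH.
have [x3C x4C] := (inC _ x3v l3, inC _ x4v l4).
have sH2 : H2 \subset C.
  have /linkedP[z zH x3z] := l3; have [zC|yz] := exC _ _ x3C x3z; last first.
    by have := H2y _ zH; rewrite in_ball -in_nbr yz orbT.
  apply: (comp_absorb CC cH2 _ zC zH); apply/subsetP => w /H2y; by rewrite in_setC.
have C3 : 3 + #|H2| <= #|C|.
  have -> : 3 + #|H2| = #|v |: (x3 |: (x4 |: H2))|.
    rewrite !cardsU1 !inE (negbTE (nout2 _ x3v)) (negbTE (nout2 _ x4v)) (negbTE vH2).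
    rewrite (negbTE x34) !orbF; have -> : v == x3 = false.
      by apply: contraTF x3v => /eqP<-; rewrite inE adj_irrefl.
    have -> // : v == x4 = false.
    by apply: contraTF x4v => /eqP<-; rewrite inE adj_irrefl.
  by apply: subset_leq_card; rewrite !subUset !sub1set vC x3C x4C.
have H20 : 0 < #|H2| by have [z zH] := conn_n0 cH2; apply/card_gt0P; exists z.
have [C3'|hC] := vbad_kind CB (ltnW d3); first by move: C3; rewrite C3'; move: H20; clear; lia.
have H23 : #|H2| = 3.
  have [//|/hex_card H26] := vbad_kind H2B (ltnW d2).
  by move: C3; rewrite (hex_card hC) H26.
have [b bH b1] : exists2 b, b \in H2 & #|nbr b| = 1.
  apply: wgt_leaf; rewrite H23; have := iso3 H23; move: d2; rewrite /deficit.
  by move: (iso _) (wgt _) => i w; clear; lia.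
by have := hex_nonleaf hC (subsetP sH2 _ bH); rewrite b1.
Qed.

Lemma deg_le3 v : #|nbr v| <= 3.
Proof.
have [//|v4] := leqP #|nbr v| 3.
case: (weigh_ball (ltnW v4)) => [[H [v3]]|[H1 [H2 [d4 bv BH nH le7]]]]; first by rewrite v3 in v4.
have [B1 B2] : H1 \in vbads v /\ H2 \in vbads v by rewrite BH !inE !eqxx orbT.
have l1 := deficit_le4 B1; have l2 := deficit_le4 B2.
have [e|e] := leqP 4 (deficit H1).
  by case: (no_degree4 d4 bv B1 B2 nH e); move: le7 l1 l2 e; clear; lia.
by case: (no_degree4 d4 bv B2 B1); rewrite 1?eq_sym //; move: le7 l1 l2 e; clear; lia.
Qed.

Lemma unique_bad3 v : 2 < #|nbr v| -> exists H, [/\ #|nbr v| = 3, vbads v = [set H],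
  1 < #|branches v| & #|branches v| <= deficit H].
Proof.
case/weigh_ball=> // -[H1 [H2 [d4]]]; by have := deg_le3 v; rewrite d4.
Qed.

Lemma nbr_triple v a b c : uniq [:: a; b; c] -> adj v a -> adj v b -> adj v c ->
  nbr v = [set a; b; c].
Proof.
move=> u va vb vc; have c3 : #|[set a; b; c]| = 3.
  have -> : [set a; b; c] = [set z in [:: a; b; c]] by apply/setP => z; rewrite !inE orbA.
  by rewrite cardsE (card_uniqP u).
apply/eqP; rewrite eq_sym eqEcard c3 deg_le3 andbT.
by apply/subsetP => z; rewrite !inE => /orP[/orP[]|]/eqP->.
Qed.

(** By [hex_reverse], the bad component [C] at a vertex [u 0] of the hexagon [H] next to
    [x] contains [v] and its other neighbours [p] and [q].  It also contains [u 2],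
    [u 3] and [u 4], as these would otherwise form a second bad component.  So [C] is
    a hexagon too, and [x] with [u 3] isolate [H], [v], [p] and [q]: each vertex they
    leave has two of its at most three neighbours dominated. *)
Lemma no_hex v H : 2 < #|nbr v| -> H \in vbads v -> ~ is_copy 6 hex_edges H.
Proof.
move=> v3 HB hH; have [cH _ _ vH exH] := vbadsP HB.
have [x [_ [xv _ _ lx _]]] := bad_linked2 HB.
have /linkedP[y yH xy] := lx; have [u L uy] := hex_rotate hH yH.
have [inj inH ad] := L.
have [y3 yN [C [CB vC d3]]] : [/\ 2 < #|nbr y|, forall z, z \in nbr y -> 1 < #|nbr z| &
   exists C, [/\ C \in vbads y, v \in C & 3 <= deficit C]].
  by rewrite -uy; apply: (hex_reverse v3 HB L xv); rewrite uy.
have [cC nTC bC yC exC] := vbadsP CB; have [CC _] := badsP _ _ CB.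
have uH i : i < 6 -> u i \in H := labels_in L.
have uN i j : i < 6 -> j < 6 -> i != j -> u i != u j.
  by move=> i6 j6; apply: contra => /eqP/inj-> //.
have nHv z : z \in H -> z \notin nbr v.
  by move/(vbads_out HB); rewrite in_ball negb_or -in_nbr => /andP[].
have xH : x \notin H by apply: contraL xv => /nHv.
have yv : y \notin ball v := vbads_out HB yH.
have Ny : nbr y = [set u 1; u 5; x].
  apply: nbr_triple; rewrite -?uy ?ad // ?uy 1?adj_sym //.
  rewrite /= !inE !negb_or uN // !andbT.
  by apply/andP; split; apply: contraNneq xH => <-; apply: uH.
have [p [q [pq pv qv px qx]]] : exists p q,
    [/\ p != q, p \in nbr v, q \in nbr v, p != x & q != x].
  have [K [Nv3 _ _ _]] := unique_bad3 v3.
  have /eqP/cards2P[p [q [pq Epq]]] : #|nbr v :\ x| = 2.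
    by have := cardsD1 x (nbr v); rewrite xv Nv3; clear; lia.
  have [] : p \in nbr v :\ x /\ q \in nbr v :\ x by rewrite Epq !inE !eqxx orbT.
  rewrite ![_ \in nbr v :\ x]in_setD1 => /andP[px pv] /andP[qx qv].
  by exists p, q.
have vC' z : z \in nbr v -> z != x -> z \in C.
  move=> zv zx; have [//|] : z \in C \/ z \in nbr y by apply: (exC v); rewrite // -in_nbr.
  rewrite Ny !inE (negbTE zx) orbF => /orP[]/eqP ez; move: zv.
    by rewrite ez (negbTE (nHv _ (uH 1 isT))).
  by rewrite ez (negbTE (nHv _ (uH 5 isT))).
have [pC qC] := (vC' _ pv px, vC' _ qv qx).
have Nv : nbr v = [set x; p; q].
  apply: nbr_triple; rewrite -?in_nbr //= !inE !negb_or pq andbT.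
  by rewrite eq_sym px eq_sym qx.
have [K [_ BC _ _]] := unique_bad3 y3; have eK : K = C.
  by move: CB; rewrite BC inE => /eqP.
rewrite {K}eK in BC.
pose Q := [set u 2; u 3; u 4].
have cQ : conn Q by apply: conn_path; rewrite ad.
have Qy z : z \in Q -> z \notin ball y.
  by case/set3P=> ->; rewrite in_ball -uy ad // orbF uN.
have sQy : Q \subset ~: ball y by apply/subsetP => z /Qy; rewrite in_setC.
have QH z : z \in Q -> z \in H by rewrite !inE => /orP[/orP[]|]/eqP->; apply: uH.
have sQC : Q \subset C.
  have [/set0Pn[z]|] := boolP (Q :&: C != set0).
    rewrite inE => /andP[zQ zC]; exact: (comp_absorb CC cQ sQy zC zQ).
  rewrite negbK => /eqP QC0; exfalso.
  have QC z : z \in Q -> z \in C -> False.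
    by move=> zQ zC; have : z \in Q :&: C by [rewrite inE zQ]; rewrite QC0 inE.
  suff QB : Q \in vbads y.
    move: QB; rewrite BC inE => /eqP QE; have := QH v; rewrite QE => /(_ vC).
    by rewrite (negbTE vH).
  apply/badsP; split; last first.
    have iQ : 0 < iso Q.
      apply: iso_gt0; apply/negP => /thinP/(_ (u 3) (u 2) (u 4)).
      rewrite !inE !eqxx !orbT !ad // => /(_ isT isT isT isT isT)/inj; by move/(_ isT isT).
    have := wgt_le4 Q; have : #|Q| <= 3.
      by rewrite /Q -setUA cardsU1 cards2; case: (_ \notin _); case: (_ != _).
    by rewrite /bad; move: iQ; move: (iso Q) (wgt Q) #|Q| => i w c; clear; lia.
  apply/compP; split=> // z w zQ; rewrite in_setC => wy zw.
  have [wH|] := exH _ _ (QH _ zQ) zw.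
    move: wy; have /inH[i i6 ->] := wH; rewrite in_ball -uy ad // !inE.
    by case: i i6 => [|[|[|[|[|[|?]]]]]] //; rewrite ?eqxx ?orbT.
  rewrite Nv !inE => wE; exfalso; have wC : w \in C.
    case/orP: wE => [/orP[]|] /eqP ew; rewrite ew // in wy *.
    by rewrite in_ball adj_sym xy orbT in wy.
  have wz : adj w z by rewrite adj_sym.
  have [zC|] := exC w z wC wz; first exact: QC zC.
  by move=> zy; have := Qy _ zQ; rewrite in_ball -in_nbr zy orbT.
pose CL := [:: v; p; q; u 2; u 3; u 4].
have nH z i : z \in nbr v -> i < 6 -> z != u i.
  by move=> zv i6; apply: contraL zv => /eqP->; apply/nHv/uH.
have vN z : z \in nbr v -> v != z.
  by apply: contraL => /eqP<-; rewrite inE adj_irrefl.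
have vu i : i < 6 -> v != u i by move=> i6; apply: contraNneq vH => ->; apply: uH.
have uCL : uniq CL.
  by rewrite /CL /= !inE !negb_or pq !vu // !uN // !nH // !vN.
have sCL : {subset CL <= C}.
  move=> z; rewrite !inE => /or4P[||/eqP->|]; [by move/eqP->|by move/eqP->|by []|].
  by move=> zQ; apply: (subsetP sQC); rewrite !inE -orbA.
have C6 : 6 <= #|C| := uniq_leq_card uCL sCL.
have hC : is_copy 6 hex_edges C.
  by have [C3|//] := vbad_kind CB (ltnW d3); rewrite C3 in C6.
have CE z : z \in C -> z \in CL.
  have : [set z in CL] \subset C by apply/subsetP => w; rewrite inE; apply: sCL.
  rewrite subEproper properEcard (hex_card hC) cardsE (card_uniqP uCL) /= ltnn andbF orbF.
  by move=> /eqP<-; rewrite inE.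
(* In [C], the ends of the path [u 2], [u 3], [u 4] continue into [p] and [q]. *)
have next i : i \in [:: 2; 4] -> exists2 z, adj (u i) z & (z == p) || (z == q).
  move=> i24; have i6 : i < 6 by move: i24; rewrite !inE => /orP[]/eqP->.
  have iC : u i \in C by apply: sCL; move: i24; rewrite !inE => /orP[]/eqP->; rewrite eqxx ?orbT.
  have /eqP/cards2P[a [b [ab Nab]]] := hex_reg hC iC.
  have [z [zi zC z3]] : exists z, [/\ adj (u i) z, z \in C & z != u 3].
    have [aN bN] : a \in nbr (u i) :&: C /\ b \in nbr (u i) :&: C.
      by rewrite Nab !inE !eqxx orbT.
    move: aN bN; rewrite ![_ \in nbr (u i) :&: C]in_setI !in_nbr => /andP[ia aC] /andP[ib bC'].
    have [a3|a3] := eqVneq a (u 3); last by exists a.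
    by exists b; split=> //; rewrite -a3 eq_sym.
  exists z => //; have := CE _ zC; rewrite /CL !inE (negbTE z3) /=.
  case/or4P=> [/eqP zv|->|->|/orP[]/eqP zE]; rewrite ?orbT //.
  - by have := nHv _ (uH _ i6); rewrite inE adj_sym -zv zi.
  - by move: zi; rewrite zE ad //; move: i24; rewrite !inE => /orP[]/eqP->.
  by move: zi; rewrite zE ad //; move: i24; rewrite !inE => /orP[]/eqP->.
have [p' [q' [pq' Epq p2 q4]]] : exists p' q', [/\ p' != q',
    [set p'; q'] = [set p; q], adj (u 2) p' & adj (u 4) q'].
  have both z : z \in C -> z \in nbr v -> adj (u 2) z -> adj (u 4) z -> False.
    move=> zC zv z2 z4; have := hex_reg hC zC.
    have : 3 <= #|nbr z :&: C|.
      apply: (@uniq_leq_card _ [:: v; u 2; u 4]).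
        by rewrite /= !inE !negb_or uN // !vu.
      have [u2C u4C] : u 2 \in C /\ u 4 \in C by split; apply: sCL; rewrite !inE eqxx ?orbT.
      move=> w; rewrite inE in_setI in_nbr => /or3P[/eqP->|/eqP->|/predU1P[->|//]].
      - by rewrite adj_sym -in_nbr zv.
      - by rewrite adj_sym z2.
      by rewrite adj_sym z4.
    by move=> /[swap] ->.
  have [z2 a2 e2] := next 2 isT; have [z4 a4 e4] := next 4 isT.
  case/orP: e2 => /eqP e2; case/orP: e4 => /eqP e4; rewrite {z2}e2 {z4}e4 in a2 a4.
  - by case: (both p).
  - by exists p, q.
  - by exists q, p; rewrite eq_sym setUC.
  - by case: (both q).
have [pq'v pq'C] : (p' \in nbr v /\ q' \in nbr v) /\ (p' \in C /\ q' \in C).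
  have sub z : z \in [set p'; q'] -> z \in nbr v /\ z \in C.
    by rewrite Epq !inE => /orP[]/eqP->; rewrite -in_nbr.
  by have [] := sub p' (set21 _ _); have [] := sub q' (set22 _ _).
case: pq'v pq'C => p'v q'v [p'C q'C].
(* The two vertices of [D] cost 28, which is the weight of [H] and [v]. *)
pose D := [set x; u 3]; pose Y := ball v :|: H.
have dx z : adj x z -> z \in closed_nbhd D.
  by move=> xz; apply: (subsetP (ball_closed (set21 x (u 3)))); rewrite in_ball xz orbT.
have d3' z : adj (u 3) z -> z \in closed_nbhd D.
  by move=> xz; apply: (subsetP (ball_closed (set22 x (u 3)))); rewrite in_ball xz orbT.
have dv : v \in closed_nbhd D by apply: dx; rewrite adj_sym -in_nbr.
have [d0 d2 d4] : [/\ u 0 \in closed_nbhd D, u 2 \in closed_nbhd D & u 4 \in closed_nbhd D].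
  by split; [apply: dx; rewrite uy|apply: d3'; rewrite ad|apply: d3'; rewrite ad].
have dD z : z \in D -> z \in closed_nbhd D := subsetP (sub_closed D) z.
have left z : z \in Y -> z \notin closed_nbhd D -> exists s t,
   [/\ s != t, adj z s, adj z t, s \in closed_nbhd D & t \in closed_nbhd D].
  rewrite inE ballE in_setU1 => zY zD.
  have {zY} : z \in H \/ z \in nbr v.
    case/orP: zY => [/predU1P[zv|zv]|zH]; [|by right|by left].
    by rewrite zv dv in zD.
  case=> [/inH[i i6 zi]|].
    case: i i6 zi => [|[|[|[|[|[|?]]]]]] // _ zi; move: zD; rewrite zi ?d0 ?d2 ?d4 //.
    - by exists (u 0), (u 2); rewrite !ad // uN.
    - by rewrite dD // !inE eqxx orbT.
    by exists (u 0), (u 4); rewrite !ad // uN.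
  rewrite Nv -setUA -Epq !inE => /or3P[]/eqP zE; rewrite zE in zD *.
  - by rewrite dD // !inE eqxx in zD.
  - by exists v, (u 2); rewrite adj_sym -in_nbr p'v adj_sym p2; split=> //; apply: vu.
  by exists v, (u 4); rewrite adj_sym -in_nbr q'v adj_sym q4; split=> //; apply: vu.
have inY w : [\/ w \in H, w = v | w \in nbr v] -> w \in Y.
  by rewrite /Y ballE 2!in_setU in_set1; case=> [->|->|->]; rewrite ?eqxx ?orbT.
have sealY : sealed D Y.
  split.
    apply/thinP => z a b; rewrite !in_setD => /andP[zD zY] /andP[aD _] /andP[bD _] za zb.
    apply/eqP/negPn/negP => ab; have [s [t [st zs zt sD tD]]] := left _ zY zD.
    suff : 4 <= #|nbr z| by rewrite leqNgt ltnS deg_le3.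
    apply: (@uniq_leq_card _ [:: s; t; a; b]); last first.
      by move=> w; rewrite !inE => /or4P[]/eqP->.
    have nd c d : c \in closed_nbhd D -> d \notin closed_nbhd D -> c != d.
      by move=> cD; apply: contraNneq => <-.
    by rewrite /= !inE !negb_or st ab !nd.
  move=> z w zY zD zw; move: zY; rewrite inE ballE in_setU1 => zY.
  have {zY} : z \in H \/ z \in nbr v.
    case/orP: zY => [/predU1P[zv|zv]|zH]; [|by right|by left].
    by rewrite zv dv in zD.
  case=> [zH|zv].
    by have [wH|wv] := exH _ _ zH zw; apply: inY; [apply: Or31|apply: Or33].
  have zC : z \in C.
    apply: vC' => //; apply: contraNneq zD => ->; apply: dD; exact: set21.
  have [wC|] := exC _ _ zC zw.
    have := CE _ wC; rewrite /CL !in_cons; case/or4P=> [/eqP->|/eqP->|/eqP->|wQ].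
    - exact/inY/Or32.
    - exact/inY/Or33.
    - exact/inY/Or33.
    by apply/inY/Or31/QH; rewrite !inE -orbA; rewrite in_nil orbF in wQ.
  by rewrite Ny => /set3P[]->; apply: inY; [apply/Or31/uH|apply/Or31/uH|apply: Or33].
have sDY : D \subset Y.
  by rewrite subUset !sub1set !inY //; [apply/Or31/uH|apply: Or33].
have wY : 28 <= wgt Y.
  have sY : v |: H \subset Y by rewrite subUset sub1set subsetUr andbT; apply/inY/Or32.
  apply: leq_trans (wgtS sY); rewrite wgtU1 // wgt_full ?(hex_card hH).
    by rewrite wt4 // eq_sym ltn_eqF // ltnW.
  by move=> z; apply: hex_nonleaf.
suff noB C' : C' \notin bads (~: Y).
  have allD C' : C' \in bads (~: Y) -> touches D C' by rewrite (negbTE (noB C')).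
  have := account0 sDY sealY allD; rewrite cards2 (contraNneq _ xH) => [|->]; last exact: uH.
  by rewrite ltnNge wY.
apply/negP => /badsP[CC' bC']; have [cC' sC' clC'] := compP _ _ CC'.
have nY z : z \in C' -> z \notin Y by move/(subsetP sC'); rewrite in_setC.
have : C' \in vbads v.
  apply/badsP; split=> //; apply/compP; split=> //.
    apply/subsetP => z /nY; rewrite in_setU negb_or => /andP[zv _]; by rewrite in_setC.
  move=> z w zC; rewrite in_setC => wv zw; apply: (clC' z) => //.
  rewrite in_setC in_setU negb_or wv /=; apply/negP => wH.
  have := nY _ zC; rewrite in_setU negb_or => /andP[zv zH].
  have wz : adj w z by rewrite adj_sym.
  have [zH'|] := exH w z wH wz; first by rewrite zH' in zH.
  by move=> zv'; rewrite in_ball -in_nbr zv' orbT in zv.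
have [K [_ BK _ _]] := unique_bad3 v3; have := HB; rewrite BK !in_set1 => /eqP eH /eqP eK.
have HK : C' = H by rewrite eK eH.
have [z zC] := conn_n0 cC'; have := nY _ zC.
by rewrite in_setU -HK zC orbT.
Qed.

(** * Vertices of degree 3 *)

Lemma iso_ge2 : 5 <= #|G| -> 1 < iso [set: G].
Proof.
move=> G5; have := wgt_ge3 [set: G]; rewrite cardsT; move: badG G5; rewrite /bad.
by move: (iso _) (wgt _) #|G| => i w c; clear; lia.
Qed.

Lemma not_thin_ball v : 5 <= #|G| -> ~~ thin (~: ball v).
Proof.
move=> G5; apply/negP => tv; have := iso_ge2 G5; rewrite ltnNge.
by rewrite (@iso_ball _ _ v) // setTD.
Qed.

Lemma three_vertices v H : 2 < #|nbr v| -> vbads v = [set H] -> 2 <= deficit H ->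
  #|H| = 3.
Proof.
move=> v3 BH d2; have HB : H \in vbads v by rewrite BH set11.
by have [//|/(no_hex v3 HB)] := vbad_kind HB d2.
Qed.

(** [x1] isolates everything unless it has a single neighbour [y1] in [H], is not
    adjacent to [x2], and [x2 - y2 - z] is a path in what it leaves. *)
Lemma seven_side v x1 x2 l H : nbr v = [set x1; x2; l] -> x1 != l ->
  nbr l = [set v] -> ~: ball v = H -> #|H| = 3 -> 5 <= #|G| -> linked x1 H ->
  ~~ adj x1 x2 /\ exists2 y1, nbr x1 :&: H = [set y1] &
    forall y2 z, nbr x2 :&: H = [set y2] -> z \in H -> z != y1 -> z != y2 ->
      H = [set y1; y2; z] -> adj y2 z.
Proof.
move=> Nv x1l Nl HE H3 G5 /linkedP[y yH x1y].
pose A := ~: ball x1; have nA : ~~ thin A := not_thin_ball x1 G5.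
have vx1 : adj x1 v by rewrite adj_sym -in_nbr Nv !inE eqxx.
have vA : v \notin A by rewrite in_setC negbK in_ball vx1 orbT.
have nAl : ~~ thin (A :\ l).
  apply: contra nA; apply: thin_isolated => w wA; apply: contraNN vA.
  by rewrite -in_nbr Nl inE => /eqP <-.
have inA w : w \in A :\ l -> w = x2 /\ ~~ adj x1 x2 \/ w \in H :\: nbr x1.
  rewrite in_setD1 in_setC in_ball negb_or => /and3P[wl wx1 nw].
  have [|wv] := boolP (w \in ball v); last by right; rewrite in_setD in_nbr nw -HE in_setC.
  rewrite in_ball => /orP[/eqP wv|]; first by rewrite wv vx1 in nw.
  rewrite -in_nbr Nv => /set3P[] ew; [by rewrite ew eqxx in wx1|left|by rewrite ew eqxx in wl].
  by rewrite -ew.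
have cD : #|H :\: nbr x1| + #|nbr x1 :&: H| = 3 by rewrite -H3 -(cardsID (nbr x1) H) addnC setIC.
have yN : y \in nbr x1 :&: H by rewrite in_setI in_nbr x1y.
have N0 : 0 < #|nbr x1 :&: H| by apply/card_gt0P; exists y.
have nx : ~~ adj x1 x2.
  apply: contra nAl => x12; apply: thin_le2.
  suff : #|A :\ l| <= #|H :\: nbr x1| by move: cD N0; clear; lia.
  by apply/subset_leq_card/subsetP => w /inA[[_]|//]; rewrite x12.
split=> //; have [/eqP/cards1P[y1 N1]|N1] := eqVneq #|nbr x1 :&: H| 1; last first.
  case/negP: nAl; apply: thin_le2.
  apply: (@leq_trans #|x2 |: (H :\: nbr x1)|).
    by apply/subset_leq_card/subsetP => w; rewrite in_setU1 => /inA[[-> _]|->]; rewrite ?eqxx ?orbT.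
  by rewrite cardsU1; move: cD N0 N1; case: (_ \notin _); clear; lia.
exists y1 => // y2 z N2 zH zy1 zy2 H_; apply/negPn/negP => y2z; case/negP: nAl.
have inA' w : w \in A :\ l -> [\/ w = x2, w = y2 | w = z].
  case/inA=> [[-> _]|]; first exact: Or31.
  rewrite in_setD => /andP[wx1 wH]; move: (wH); rewrite {1}H_ => /set3P[] ew; last first.
  - exact: Or33.
  - exact: Or32.
  have : y1 \in nbr x1 :&: H by rewrite N1 set11.
  by rewrite -ew in_setI (negbTE wx1).
apply: (@thin_isolated _ z) => [w /inA'[]->|].
- apply: contra zy2 => zx2; have : z \in nbr x2 :&: H by rewrite in_setI in_nbr adj_sym zx2.
  by rewrite N2 inE.
- by rewrite adj_sym.
- by rewrite adj_irrefl.
apply: thin_le2; apply: (@leq_trans #|[set x2; y2]|); last by rewrite cards2; case: (_ != _).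
apply/subset_leq_card/subsetP => w; rewrite in_setD1 => /andP[wz /inA'[]ew].
- by rewrite ew set21.
- by rewrite ew set22.
by rewrite ew eqxx in wz.
Qed.

(** Here the graph consists of [v], [x1], [x2], the leaf [l] and the three vertices of
    [H].  By [seven_side] for [x1] and for [x2], it is isolated by one vertex unless
    [v - x1 - y1 - z - y2 - x2] is a 6-cycle whose only possible chord is [y1 y2]: this
    is [C_6'] or [C_6'']. *)
Lemma seven_vertices v x1 x2 l H : nbr v = [set x1; x2; l] -> uniq [:: x1; x2; l] ->
  nbr l = [set v] -> ~: ball v = H -> conn H -> #|H| = 3 ->
  linked x1 H -> linked x2 H -> False.
Proof.
move=> Nv Ux Nl HE cH H3 l1 l2.
have [x12 x1l x2l] : [/\ x1 != x2, x1 != l & x2 != l].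
  by move: Ux; rewrite /= !inE negb_or andbT => /andP[/andP[-> ->] ->].
have G5 : 5 <= #|G|.
  have := cardsC (ball v); rewrite HE H3 card_ball.
  suff -> : #|nbr v| = 3 by move=> <-.
  have -> : nbr v = [set z in [:: x1; x2; l]] by rewrite Nv; apply/setP => z; rewrite !inE orbA.
  by rewrite cardsE (card_uniqP Ux).
have Nv' : nbr v = [set x2; x1; l] by rewrite Nv [[set x1; x2]]setUC.
have [nx [y1 N1 side1]] := seven_side Nv x1l Nl HE H3 G5 l1.
have [_ [y2 N2 side2]] := seven_side Nv' x2l Nl HE H3 G5 l2.
have [vx1 vx2 vl] : [/\ adj v x1, adj v x2 & adj v l] by rewrite -!in_nbr Nv !inE !eqxx !orbT.
have nvH w : w \in H -> w \notin ball v by rewrite -HE in_setC.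
have vH w : w \in H -> adj v w = false.
  by move/nvH; rewrite in_ball negb_or => /andP[_ /negbTE].
have lH w : w != v -> adj l w = false.
  by move=> wv; apply/negbTE; apply: contra wv; rewrite -in_nbr Nl inE.
have inb w : w \in H -> w != v by move/nvH; apply: contraNneq => ->; rewrite in_ball eqxx.
have [y1H x1y1] : y1 \in H /\ adj x1 y1.
  by have : y1 \in nbr x1 :&: H by [rewrite N1 set11]; rewrite in_setI in_nbr => /andP[].
have [y2H x2y2] : y2 \in H /\ adj x2 y2.
  by have : y2 \in nbr x2 :&: H by [rewrite N2 set11]; rewrite in_setI in_nbr => /andP[].
have [ey|ny] := eqVneq y1 y2.
  have [y' y'H y1y'] := conn3_nbr cH H3 y1H.
  have /eqP/cards1P[h Hh] : #|H :\ y1 :\ y'| = 1.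
    have y'1 : y' != y1 by apply: contraTneq y1y' => ->; rewrite adj_irrefl.
    have := cardsD1 y' (H :\ y1); rewrite in_setD1 y'1 y'H.
    by have := cardsD1 y1 H; rewrite y1H H3; clear; lia.
  have hH : h \in H by have := set11 h; rewrite -Hh => /setD1P[_ /setD1P[]].
  case/negP: (not_thin_ball y1 G5).
  have inA w : w \in ~: ball y1 -> [\/ w = v, w = l | w = h].
    rewrite in_setC in_ball negb_or => /andP[wy yw].
    have [|wv] := boolP (w \in ball v).
      rewrite in_ball => /orP[/eqP|]; first exact: Or31.
      rewrite -in_nbr Nv => /set3P[] ew; last exact: Or32.
        by rewrite ew adj_sym x1y1 in yw.
      by rewrite ew ey adj_sym x2y2 in yw.
    apply: Or33; apply/set1P; rewrite -Hh !in_setD1 wy -HE in_setC wv !andbT.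
    by apply: contraNneq yw => ->.
  apply: (@thin_isolated _ h) => [w /inA[]->|].
  - by rewrite adj_sym vH.
  - by rewrite adj_sym lH // inb.
  - by rewrite adj_irrefl.
  apply: thin_le2; apply: (@leq_trans #|[set v; l]|); last by rewrite cards2; case: (_ != _).
  apply/subset_leq_card/subsetP => w; rewrite in_setD1 => /andP[wh /inA[]ew].
  - by rewrite ew set21.
  - by rewrite ew set22.
  by rewrite ew eqxx in wh.
have /eqP/cards1P[z Hz] : #|H :\ y1 :\ y2| = 1.
  have := cardsD1 y2 (H :\ y1); rewrite in_setD1 eq_sym ny y2H.
  by have := cardsD1 y1 H; rewrite y1H H3; clear; lia.
have : z \in H :\ y1 :\ y2 by rewrite Hz set11.
rewrite !in_setD1 => /and3P[zy2 zy1 zH].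
have H_ : H = [set y1; y2; z].
  rewrite -setUA -[[set y2; z]]/(y2 |: [set z]) -Hz setD1K ?setD1K //.
  by rewrite in_setD1 eq_sym ny.
have H_' : H = [set y2; y1; z] by rewrite H_ [[set y1; y2]]setUC.
have ny' : y2 != y1 by rewrite eq_sym.
have y2z := side1 _ _ N2 zH zy1 zy2 H_; have y1z := side2 _ _ N1 zH zy2 zy1 H_'.
have only1 w : w \in H -> w != y1 -> adj x1 w = false.
  move=> wH wy; apply/negbTE; apply: contra wy => xw; rewrite -in_set1 -N1.
  by rewrite in_setI in_nbr xw.
have only2 w : w \in H -> w != y2 -> adj x2 w = false.
  move=> wH wy; apply/negbTE; apply: contra wy => xw; rewrite -in_set1 -N2.
  by rewrite in_setI in_nbr xw.
have vx w : adj v w -> v != w by apply: contraTneq => <-; rewrite adj_irrefl.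
have vh w : w \in H -> v != w by move/inb; rewrite eq_sym.
have xh w w' : adj v w -> w' \in H -> w != w'.
  by move=> vw w'H; apply: contraTneq vw => ->; rewrite vH.
have xv w : adj v w -> w != v by move/vx; rewrite eq_sym.
pose us := [:: v; x1; y1; z; y2; x2; l].
have uus : uniq us.
  rewrite /us /= !inE !negb_or.
  by do ![apply/andP; split]; first [done | exact: vx | exact: vh | exact: xh
    | by rewrite eq_sym; first [done | exact: xh]].
have usT w : (w \in [set: G]) = (w \in us).
  rewrite inE; apply/esym; have [|wv] := boolP (w \in ball v).
    rewrite in_ball => /orP[/eqP->|]; first by rewrite !inE eqxx.
    by rewrite -in_nbr Nv => /set3P[]->; rewrite !inE eqxx ?orbT.
  have : w \in H by rewrite -HE in_setC.
  by rewrite H_ => /set3P[]->; rewrite !inE eqxx ?orbT.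
have [y12|y12] := boolP (adj y1 y2); apply: nexcG; apply: Or33.
  exists (7, hex''_edges) => //; apply: (copy_seq (x0 := v) uus usT) => i j.
  case: j => [|[|[|[|[|[|[|j]]]]]]]; case: i => [|[|[|[|[|[|[|i]]]]]]] // _ _; rewrite /us /nth.
  all: try by rewrite ?vx1 ?vx2 ?vl ?x1y1 ?y1z ?y12.
  all: try by rewrite adj_sym ?y2z ?x2y2.
  all: try by rewrite vH.
  all: try by rewrite only1.
  all: try by rewrite adj_sym only2.
  all: try by rewrite adj_sym lH //; first [exact: xv | exact: inb].
  by rewrite (negbTE nx).
exists (7, hex'_edges) => //; apply: (copy_seq (x0 := v) uus usT) => i j.
case: j => [|[|[|[|[|[|[|j]]]]]]]; case: i => [|[|[|[|[|[|[|i]]]]]]] // _ _; rewrite /us /nth.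
all: try by rewrite ?vx1 ?vx2 ?vl ?x1y1 ?y1z ?(negbTE y12).
all: try by rewrite adj_sym ?y2z ?x2y2.
all: try by rewrite vH.
all: try by rewrite only1.
all: try by rewrite adj_sym only2.
all: try by rewrite adj_sym lH //; first [exact: xv | exact: inb].
by rewrite (negbTE nx).
Qed.

(** The neighbours of [x1] are [v], [y] and [j], so [x1] takes care of these and of [l],
    which weigh at least 18 together.  A component of the rest that avoids [x2] is part
    of [H] without [y], or hangs from [j] and is not bad by [cut_vertex].  So at most one
    bad component remains, and 18 pays for [x1] and for its deficit. *)
Lemma leaf_beyond v x1 x2 l H j : nbr v = [set x1; x2; l] -> uniq [:: x1; x2; l] ->
  nbr l = [set v] -> H \in vbads v -> #|H| = 3 -> linked x1 H ->
  j \notin ball v -> j \notin H -> adj x1 j -> False.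
Proof.
move=> Nv Ux Nl HB H3 /linkedP[y yH x1y] jv jH x1j.
have [cH nTH bH vH exH] := vbadsP HB; have [CH _] := badsP _ _ HB.
have [x12 x1l x2l] : [/\ x1 != x2, x1 != l & x2 != l].
  by move: Ux; rewrite /= !inE negb_or andbT => /andP[/andP[-> ->] ->].
have [vx1 vx2 vl] : [/\ adj v x1, adj v x2 & adj v l] by rewrite -!in_nbr Nv !inE !eqxx !orbT.
have nb w : w \in ball v -> w != j by apply: contraTneq => ->.
have Hb w : w \in H -> w \notin ball v := vbads_out HB.
have inb w : adj v w -> w \in ball v by rewrite in_ball => ->; rewrite orbT.
have vv : v \in ball v by rewrite in_ball eqxx.
have bH' w w' : w \in ball v -> w' \in H -> w != w'.
  by move=> wv w'H; apply: contraTneq wv => ->; apply: Hb.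
have vj : v != j := nb _ vv.
have yj : y != j by apply: contraNneq jH => <-.
have vy : v != y := bH' _ _ vv yH.
have Nx1 : nbr x1 = [set v; y; j].
  by apply: nbr_triple; rewrite /= ?inE ?negb_or ?vy ?vj ?yj // adj_sym.
have x1v : x1 != v by apply: contraTneq vx1 => ->; rewrite adj_irrefl.
have lv : l != v by apply: contraTneq vl => ->; rewrite adj_irrefl.
have x2v : x2 != v by apply: contraTneq vx2 => ->; rewrite adj_irrefl.
pose D := [set x1]; pose Y := x1 |: (v |: (y |: [set l; j])).
have inY w : w \in Y -> [\/ w = x1, w = v, w = y | w \in [set l; j]].
  rewrite !in_setU1 => /or4P[/eqP|/eqP|/eqP|]; by [exact: Or41|exact: Or42|exact: Or43|exact: Or44].
have [Y1 Yv Yy] : [/\ x1 \in Y, v \in Y & y \in Y] by rewrite !inE !eqxx !orbT.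
have [Yl Yj] : l \in Y /\ j \in Y by rewrite !inE !eqxx !orbT.
have wY : 18 <= wgt Y.
  have y4 : wt y = 4.
    apply: wt4; rewrite eq_sym ltn_eqF //; have [z zH yz] := conn3_nbr cH H3 yH.
    apply: (@nbr_gt1 y x1 z); rewrite // 1?adj_sym //; exact: bH' (inb _ vx1) zH.
  have v4 : wt v = 4 by apply: wt4; rewrite eq_sym ltn_eqF // (nbr_gt1 vx1 vx2 x12).
  have x14 : wt x1 = 4.
    by apply: wt4; rewrite eq_sym ltn_eqF // (nbr_gt1 x1y x1j yj).
  rewrite /Y !wgtU1 ?wgt1 ?x14 ?v4 ?y4.
  - by have := wt_ge3 l; have := wt_ge3 j; clear; lia.
  - by rewrite inE nb // inb.
  - by rewrite !inE negb_or yj andbT eq_sym bH' // inb.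
  - by rewrite !inE !negb_or vy vj andbT eq_sym lv.
  by rewrite !inE !negb_or x1v x1l bH' ?inb // nb ?inb.
have sDY : D \subset Y by rewrite sub1set.
have cD w : adj x1 w -> w \in closed_nbhd D.
  by move=> xw; apply: (subsetP (ball_closed (set11 x1))); rewrite in_ball xw orbT.
have dx1 : x1 \in closed_nbhd D by rewrite (subsetP (sub_closed D)) // set11.
have left w : w \in Y -> w \notin closed_nbhd D -> w = l.
  move=> /inY[->|->|->|/set2P[]->] //; first by rewrite dx1.
  - by rewrite cD // adj_sym.
  - by rewrite cD.
  by rewrite cD.
have sealY : sealed D Y.
  split=> [|w z wY' wD].
    apply/thinP => a b c; rewrite !in_setD => /andP[aD aY] /andP[bD bY] _.
    by rewrite (left _ aY aD) (left _ bY bD) adj_irrefl.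
  by rewrite (left _ wY' wD) -in_nbr Nl inE => /eqP->.
have bad2 C : C \in bads (~: Y) -> x2 \in C.
  move=> CB; apply/negPn/negP => x2C; have [CC bC] := badsP _ _ CB.
  have [cC sC clC] := compP _ _ CC.
  have nY w : w \in C -> w \notin Y by move/(subsetP sC); rewrite in_setC.
  have notC w w' : w' \in Y -> w \in C -> w != w'.
    by move=> w'Y wC; apply: contraTneq w'Y => <-; apply: nY.
  have nbC w : w \in C -> w \notin ball v.
    move=> wC; rewrite in_ball negb_or notC //=; apply/negP.
    rewrite -in_nbr Nv => /set3P[] e.
    - by have := notC _ _ Y1 wC; rewrite e eqxx.
    - by rewrite -e wC in x2C.
    by have := notC _ _ Yl wC; rewrite e eqxx.
  have sCv : C \subset ~: ball v by apply/subsetP => w /nbC; rewrite in_setC.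
  have [/set0Pn[w]|CH0] := boolP (C :&: H != set0).
    rewrite inE => /andP[wC wH]; have sCH := comp_absorb CH cC sCv wH wC.
    have : C \subset H :\ y.
      by apply/subsetP => a aC; rewrite in_setD1 notC // (subsetP sCH).
    move/subset_leq_card; have := cardsD1 y H; rewrite yH H3 => e leC.
    have : #|C| <= 2 by move: e leC; clear; lia.
    by move/thin_le2/iso_thin => i0; move: bC; rewrite /bad i0.
  have nH w : w \in C -> w \notin H.
    by move=> wC; apply: contra CH0 => wH; apply/set0Pn; exists w; rewrite inE wC.
  have onlyj c w : c \in C -> w \in Y -> adj c w -> w = j.
    move=> cC' /inY wE; rewrite adj_sym => wc; case: wE => [e|e|e|]; rewrite ?e in wc.
    - move: wc; rewrite -in_nbr Nx1 => /set3P[] ec.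
      + by have := notC _ _ Yv cC'; rewrite ec eqxx.
      + by have := notC _ _ Yy cC'; rewrite ec eqxx.
      by have := notC _ _ Yj cC'; rewrite ec eqxx.
    - by have := nbC _ cC'; rewrite inb.
    - have [cH'|cv] := exH _ _ yH wc; first by have := nH _ cC'; rewrite cH'.
      by have := nbC _ cC'; rewrite inb // -in_nbr.
    case/set2P=> // e; move: wc; rewrite e -in_nbr Nl inE => /eqP ec.
    by have := notC _ _ Yv cC'; rewrite ec eqxx.
  have [c [w [cC' _ wY' cw]]] := comp_exit CC (comp_neqT CC Y1).
  have wj : w = j by apply: (onlyj c); rewrite // -[Y]setCK inE.
  have j2 : 1 < #|nbr j|.
    apply: (@nbr_gt1 j x1 c); first by rewrite adj_sym.
      by rewrite adj_sym -wj.
    by rewrite eq_sym notC.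
  have [c' [w' [c'C w'Y nw cw']]] := bad_exit2 CB Yj j2.
  by rewrite (onlyj _ _ c'C w'Y cw') eqxx in nw.
have D0 : D != set0 by apply/set0Pn; exists x1; rewrite set11.
have lt : wgt Y < 14 * #|D| + 4.
  apply: account_le1 => // C C' CB CB' _ _.
  exact: comp_eq (badsP _ _ CB).1 (badsP _ _ CB').1 (bad2 _ CB) (bad2 _ CB').
by move: wY lt; rewrite cards1; clear; lia.
Qed.

Lemma nbr_leaf v l : adj v l -> #|nbr l| = 1 -> nbr l = [set v].
Proof.
move=> vl /eqP/cards1P[w Nw]; rewrite Nw; congr [set _]; apply/esym/eqP.
by rewrite -in_set1 -Nw inE adj_sym.
Qed.

(** Since hexagons are excluded, the bad component at [v] has three vertices, and
    either there is nothing else ([seven_vertices]) or some vertex lies beyond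
    ([leaf_beyond]). *)
Lemma no_leaf3 v l : 2 < #|nbr v| -> adj v l -> #|nbr l| <> 1.
Proof.
move=> v3 vl l1; have Nl := nbr_leaf vl l1.
have [H [Nv3 BH t1 tH]] := unique_bad3 v3; have HB : H \in vbads v by rewrite BH set11.
have H3 := three_vertices v3 BH (leq_trans t1 tH).
have [cH nTH bH vH exH] := vbadsP HB.
have [x1 [x2 [x1v x2v x12 l1' l2']]] := bad_linked2 HB; rewrite !in_nbr in x1v x2v.
have nl x : x \in nbr v -> linked x H -> x != l.
  by move=> xv lx; apply: contraTneq (linked_gt1 HB xv lx) => ->; rewrite l1.
have Ux : uniq [:: x1; x2; l] by rewrite /= !inE negb_or x12 !nl // in_nbr.
have Nv := nbr_triple Ux x1v x2v vl.
have [/eqP HE|nHE] := eqVneq (~: ball v) H; first exact: (seven_vertices Nv Ux Nl (eqP HE) cH H3).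
have [j0 jv jH] : exists2 j, j \notin ball v & j \notin H.
  have /subsetPn[j] : ~~ (~: ball v \subset H).
    apply: contra nHE => sH; rewrite eqEsubset sH /=.
    by apply/subsetP => w /(vbads_out HB); rewrite in_setC.
  by rewrite in_setC; exists j.
have vA : v \in ball v :|: H by rewrite in_setU in_ball eqxx.
have nT : ~~ ([set: G] \subset ball v :|: H).
  by apply/subsetPn; exists j0; rewrite ?in_setT // in_setU negb_or jv.
have [a [j [aA _ _ jA aj]]] := conn_exit connG vA (in_setT v) nT.
move: jA; rewrite in_setU negb_or => /andP[{}jv {}jH].
move: aA; rewrite in_setU in_ball => /orP[/orP[/eqP av|va]|aH].
- by rewrite in_ball -av aj orbT in jv.
- move: va; rewrite -in_nbr Nv => /set3P[] ea; rewrite {a}ea in aj.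
  + exact: leaf_beyond Nv Ux Nl HB H3 l1' jv jH aj.
  + have Ux' : uniq [:: x2; x1; l] by rewrite /= !inE negb_or eq_sym x12 !nl // in_nbr.
    have Nv' : nbr v = [set x2; x1; l] by rewrite Nv [[set x1; x2]]setUC.
    exact: leaf_beyond Nv' Ux' Nl HB H3 l2' jv jH aj.
  by move: aj jv; rewrite -in_nbr Nl inE => /eqP->; rewrite in_ball eqxx.
have [jH'|jv'] := exH _ _ aH aj; first by rewrite jH' in jH.
by rewrite in_ball -in_nbr jv' orbT in jv.
Qed.

(** As [v] has no leaf, its bad component has deficit 3 at least: it is a path
    [a - h - b] ending in a leaf [b].  By [no_leaf3] the vertex [h] has degree 2, so
    [a] is adjacent to two neighbours [x1] and [x2] of [v].  Then [a] takes care of the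
    path and of [x1], and the bad components that remain have a neighbour of [a]. *)
Lemma deg_le2 v : #|nbr v| <= 2.
Proof.
rewrite leqNgt; apply/negP => v3.
have [H [Nv3 BH t1 tH]] := unique_bad3 v3; have HB : H \in vbads v by rewrite BH set11.
have H3 := three_vertices v3 BH (leq_trans t1 tH).
have vN x : x \in nbr v -> 1 < #|nbr x|.
  rewrite inE => vx; have : 0 < #|nbr x| by apply/card_gt0P; exists v; rewrite inE adj_sym.
  by have := no_leaf3 v3 vx; case: #|nbr x| => [|[]].
have d3 := deficit_ge3 v3 vN HB.
have [cH nTH bH vH exH] := vbadsP HB; have [CH _] := badsP _ _ HB.
have [b bH' b1] : exists2 b, b \in H & #|nbr b| = 1.
  apply: wgt_leaf; rewrite H3; have := iso3 H3; move: d3; rewrite /deficit.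
  by move: (iso _) (wgt _) => i w; clear; lia.
have [h hH bh] := conn3_nbr cH H3 bH'.
have Nb : nbr b = [set h] by apply: nbr_leaf => //; rewrite adj_sym.
have h2 : #|nbr h| <= 2.
  by rewrite leqNgt; apply/negP => h3; case: (no_leaf3 h3 _ b1); rewrite adj_sym.
have bnh : b != h by apply: contraTneq bh => ->; rewrite adj_irrefl.
have /eqP/cards1P[a Ha] : #|H :\ b :\ h| = 1.
  have := cardsD1 h (H :\ b); rewrite in_setD1 eq_sym bnh hH.
  by have := cardsD1 b H; rewrite bH' H3; clear; lia.
have : a \in H :\ b :\ h by rewrite Ha set11.
rewrite !in_setD1 => /and3P[ah ab aH].
have HE : H = [set b; h; a].
  rewrite -setUA -[[set h; a]]/(h |: [set a]) -Ha setD1K ?setD1K //.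
  by rewrite in_setD1 eq_sym bnh.
have [h' h'H ah'] := conn3_nbr cH H3 aH.
have adjah : adj a h.
  move: h'H; rewrite HE => /set3P[] e; rewrite {h'}e // in ah'.
    by move: ah'; rewrite adj_sym -in_nbr Nb inE (negbTE ah).
  by rewrite adj_irrefl in ah'.
have Nh : nbr h = [set a; b].
  apply/eqP; rewrite eq_sym eqEcard cards2 ab h2 andbT.
  by apply/subsetP => w /set2P[]->; rewrite inE adj_sym.
have nHv w : w \in H -> w \notin nbr v.
  by move/(vbads_out HB); rewrite in_ball negb_or -in_nbr => /andP[].
have [x1 [x2 [x1v x2v x12 l1 l2]]] := bad_linked2 HB.
have la x : x \in nbr v -> linked x H -> adj a x.
  move=> xv /linkedP[y yH xy]; have xH : x \notin H by apply: contraL xv => /nHv.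
  move: yH; rewrite {1}HE => /set3P[] e; rewrite {y}e adj_sym // in xy *.
    by move: xy; rewrite -in_nbr Nb inE => /eqP e; rewrite e hH in xH.
  by move: xy; rewrite -in_nbr Nh => /set2P[] e; rewrite e ?aH ?bH' in xH.
have [ax1 ax2] := (la _ x1v l1, la _ x2v l2).
pose D := [set a]; pose Y := x1 |: H.
have x1H : x1 \notin H by apply: contraL x1v => /nHv.
have cD w : adj a w -> w \in closed_nbhd D.
  by move=> xw; apply: (subsetP (ball_closed (set11 a))); rewrite in_ball xw orbT.
have da : a \in closed_nbhd D by rewrite (subsetP (sub_closed D)) // set11.
have left w : w \in Y -> w \notin closed_nbhd D -> w = b.
  rewrite in_setU1 HE => /predU1P[->|/set3P[]->] //; by rewrite ?da ?cD.
have sealY : sealed D Y.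
  split=> [|w z wY' wD].
    apply/thinP => p q r; rewrite !in_setD => /andP[pD pY] /andP[qD qY] _.
    by rewrite (left _ pY pD) (left _ qY qD) adj_irrefl.
  by rewrite (left _ wY' wD) -in_nbr Nb inE => /eqP->; rewrite in_setU1 hH orbT.
have wY : 15 <= wgt Y.
  rewrite wgtU1 // wt4; last by rewrite eq_sym ltn_eqF // vN.
  have -> : H = [set a; h; b].
    by rewrite HE; apply/setP => w; rewrite !inE; case: (w == a) (w == h) (w == b) => [] [] [].
  rewrite wgt_path 1?adj_sym // (@wt4 _ a); first by have := wt_ge3 b; clear; lia.
  by rewrite eq_sym ltn_eqF // (nbr_gt1 ax1 ax2).
have sDY : D \subset Y by rewrite sub1set in_setU1 aH orbT.
have Y1 : x1 \in Y by rewrite in_setU1 eqxx.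
suff allD C : C \in bads (~: Y) -> touches D C.
  by have := account0 sDY sealY allD; rewrite cards1; move: wY; clear; lia.
move=> CB; have [CC bC] := badsP _ _ CB; have [cC sC clC] := compP _ _ CC.
have nY w : w \in C -> w \notin Y by move/(subsetP sC); rewrite in_setC.
have [c [w [c'C wY' wx cw]]] := bad_exit2 CB Y1 (vN _ x1v).
suff [x xC ax] : exists2 x, x \in C & adj a x.
  by apply/set0Pn; exists x; rewrite inE xC cD.
move: wY'; rewrite in_setU1 (negbTE wx) /= HE => /set3P[] e; rewrite {w wx}e adj_sym in cw.
- move: cw; rewrite -in_nbr Nb inE => /eqP e; have := nY _ c'C.
  by rewrite e in_setU1 hH orbT.
- move: cw; rewrite -in_nbr Nh => /set2P[] e; have := nY _ c'C.
    by rewrite e in_setU1 aH orbT.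
  by rewrite e in_setU1 bH' orbT.
by exists c.
Qed.

(** * Maximum degree 2 *)

Lemma not_thin : ~~ thin [set: G].
Proof. by apply/negP => /iso_thin i0; move: badG; rewrite /bad i0. Qed.

Lemma small_closed A x : x \in A -> #|A| <= 3 ->
  (forall y z, y \in A -> adj y z -> z \in A) -> False.
Proof.
move=> xA A3 /(conn_full xA) AT.
have [A2|A3'] := leqP #|A| 2; first by have := not_thin; rewrite -AT thin_le2.
by apply: nexcG; apply: Or31; rewrite -AT; apply/eqP; rewrite eqn_leq A3.
Qed.

Lemma card_set3 a b c : #|[set a; b; c : G]| <= 3.
Proof. by rewrite -setUA cardsU1 cards2; case: (_ \notin _); case: (_ != _). Qed.

Lemma nbr_gt0 v : 0 < #|nbr v|.
Proof.
rewrite lt0n cards_eq0; apply/negP => /eqP Nv.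
apply: (@small_closed [set v] v); rewrite ?set11 ?cards1 // => y z /set1P->.
by rewrite -in_nbr Nv in_set0.
Qed.

Lemma nbr_other v x : adj v x -> #|nbr v| != 1 -> exists2 y, nbr v = [set x; y] & y != x.
Proof.
move=> vx v1; have v2 := deg_le2 v; have v0 := nbr_gt0 v.
have /eqP/cards1P[y Ny] : #|nbr v :\ x| = 1.
  have := cardsD1 x (nbr v); rewrite in_nbr vx; move: v1 v2 v0.
  by move: #|nbr v| #|nbr v :\ x| => a b; clear; lia.
have : y \in nbr v :\ x by rewrite Ny set11.
rewrite in_setD1 => /andP[yx yv]; exists y => //.
by rewrite -Ny [RHS]setD1K // in_nbr.
Qed.

(** Along the path [u1 - u2 - u3 - u4] from a leaf [u1], the vertex [u3] takes care of
    these four vertices, of weight at least 14, and the rest hangs from [u4]. *)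
Lemma no_leaf (u1 : G) : #|nbr u1| <> 1.
Proof.
move=> n1; have /eqP/cards1P[u2 N1] := n1.
have a12 : adj u1 u2 by rewrite -in_nbr N1 set11.
have a21 : adj u2 u1 by rewrite adj_sym.
have [n2|n2] := eqVneq #|nbr u2| 1.
  have N2 := nbr_leaf a12 n2; apply: (@small_closed [set u1; u2] u1).
  - exact: set21.
  - by rewrite cards2; case: (_ != _).
  by move=> y z /set2P[]->; rewrite -in_nbr ?N1 ?N2 => /set1P->; rewrite !inE eqxx ?orbT.
have [u3 N2 u31] := nbr_other a21 n2.
have a23 : adj u2 u3 by rewrite -in_nbr N2 set22.
have a32 : adj u3 u2 by rewrite adj_sym.
have [n3|n3] := eqVneq #|nbr u3| 1.
  have N3 := nbr_leaf a23 n3; apply: (@small_closed [set u1; u2; u3] u1).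
  - by rewrite !inE eqxx.
  - exact: card_set3.
  move=> y z /set3P[]->; rewrite -in_nbr ?N1 ?N2 ?N3;
    [move=> /set1P->|move=> /set2P[]->|move=> /set1P->]; by rewrite !inE eqxx ?orbT.
have [u4 N3 u42] := nbr_other a32 n3.
have a34 : adj u3 u4 by rewrite -in_nbr N3 set22.
have u12 : u1 != u2 by apply: contraTneq a12 => ->; rewrite adj_irrefl.
have u23 : u2 != u3 by apply: contraTneq a23 => ->; rewrite adj_irrefl.
have u34 : u3 != u4 by apply: contraTneq a34 => ->; rewrite adj_irrefl.
have u14 : u1 != u4.
  by apply: contraTneq a34 => <-; rewrite adj_sym -in_nbr N1 inE eq_sym.
pose D := [set u3]; pose Y := u1 |: (u2 |: (u3 |: [set u4])).
have [Y1 Y2 Y3] : [/\ u1 \in Y, u2 \in Y & u3 \in Y] by rewrite !inE !eqxx ?orbT.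
have Y4 : u4 \in Y by rewrite !inE !eqxx ?orbT.
have inY w : w \in Y -> [\/ w = u1, w = u2, w = u3 | w = u4].
  rewrite !in_setU1 in_set1 => /or4P[]/eqP;
    by [exact: Or41|exact: Or42|exact: Or43|exact: Or44].
have wY : 14 <= wgt Y.
  rewrite /Y !wgtU1 ?wgt1 ?(wt3 n1) ?(wt4 n2) ?(wt4 n3) ?inE ?negb_or //.
  - by have := wt_ge3 u4; clear; lia.
  - by rewrite u23 eq_sym.
  by rewrite u12 eq_sym u31.
have cD w : adj u3 w -> w \in closed_nbhd D.
  by move=> xw; apply: (subsetP (ball_closed (set11 u3))); rewrite in_ball xw orbT.
have d3 : u3 \in closed_nbhd D by rewrite (subsetP (sub_closed D)) // set11.
have left w : w \in Y -> w \notin closed_nbhd D -> w = u1.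
  by move=> /inY[]-> //; rewrite ?d3 ?cD.
have sealY : sealed D Y.
  split=> [|w z wY' wD].
    apply/thinP => p q r; rewrite !in_setD => /andP[pD pY] /andP[qD qY] _.
    by rewrite (left _ pY pD) (left _ qY qD) adj_irrefl.
  by rewrite (left _ wY' wD) -in_nbr N1 inE => /eqP->.
have sDY : D \subset Y by rewrite sub1set.
suff noB C : C \notin bads (~: Y).
  have allD C : C \in bads (~: Y) -> touches D C by rewrite (negbTE (noB C)).
  by have := account0 sDY sealY allD; rewrite cards1 muln1 ltnNge wY.
apply/negP => CB; have [CC bC] := badsP _ _ CB; have [cC sC clC] := compP _ _ CC.
have notC w w' : w' \in Y -> w \in C -> w != w'.
  move=> w'Y wC; apply: contraTneq w'Y => <-.
  by have := subsetP sC _ wC; rewrite in_setC.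
have only4 c w : c \in C -> w \in Y -> adj c w -> w = u4.
  move=> cC' /inY[]-> //; rewrite adj_sym -in_nbr ?N1 ?N2 ?N3.
  - by move/set1P=> e; have := notC _ _ Y2 cC'; rewrite e eqxx.
  - case/set2P=> e; first by have := notC _ _ Y1 cC'; rewrite e eqxx.
    by have := notC _ _ Y3 cC'; rewrite e eqxx.
  case/set2P=> e; first by have := notC _ _ Y2 cC'; rewrite e eqxx.
  by have := notC _ _ Y4 cC'; rewrite e eqxx.
have [c [w [cC' _ wY' cw]]] := comp_exit CC (comp_neqT CC Y1).
have w4 : w = u4 by apply: (only4 c); rewrite // -[Y]setCK inE.
have n4 : 1 < #|nbr u4|.
  apply: (@nbr_gt1 u4 u3 c); first by rewrite adj_sym.
    by rewrite adj_sym -w4.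
  by rewrite eq_sym notC.
have [c' [w' [c'C w'Y nw cw']]] := bad_exit2 CB Y4 n4.
by rewrite (only4 _ _ c'C w'Y cw') eqxx in nw.
Qed.

Lemma card_nbr2 v : #|nbr v| = 2.
Proof. by have := deg_le2 v; have := nbr_gt0 v; have := @no_leaf v; case: #|nbr v| => [|[|[|]]]. Qed.

Lemma nbr_pair v x y : adj v x -> adj v y -> x != y -> nbr v = [set x; y].
Proof.
move=> vx vy xy; apply/eqP; rewrite eq_sym eqEcard cards2 xy card_nbr2 andbT.
by apply/subsetP => z /set2P[]->; rewrite inE.
Qed.

(** What remains is a cycle.  The two vertices next to [N[v]] become leaves when [N[v]]
    is removed; the two units of weight so saved complete the 12 of [N[v]] to 14.  This
    uses the weight [wgt_in] of the components, so they must not be exceptional: if one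
    were, it would be a path on three vertices and the graph would be [C_6]. *)
Lemma no_minimal_counterexample : False.
Proof.
have [v _] := conn_n0 connG.
have n1 (w : G) : #|nbr w| != 1 by rewrite card_nbr2.
have /eqP/cards2P[x [x' [xx' Nv]]] := card_nbr2 v.
have [vx vx'] : adj v x /\ adj v x' by rewrite -!in_nbr Nv !inE !eqxx orbT.
have [xv x'v] : adj x v /\ adj x' v by rewrite ![adj _ v]adj_sym.
have [z Nx zv] := nbr_other xv (n1 x); have [z' Nx' z'v] := nbr_other x'v (n1 x').
have [xz x'z'] : adj x z /\ adj x' z' by rewrite -!in_nbr Nx Nx' !inE !eqxx !orbT.
have irr (a b : G) : adj a b -> a != b by apply: contraTneq => ->; rewrite adj_irrefl.
have nxx : ~~ adj x x'.
  apply/negP => axx; have axx' : adj x' x by rewrite adj_sym.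
  have Ex := nbr_pair xv axx (irr _ _ vx'); have Ex' := nbr_pair x'v axx' (irr _ _ vx).
  apply: (@small_closed [set v; x; x'] v); rewrite ?card_set3 ?inE ?eqxx //.
  move=> a b /set3P[]->; rewrite -in_nbr ?Nv ?Ex ?Ex' => /set2P[]->;
  by rewrite !inE eqxx ?orbT.
have zx' : z != x' by apply: contraNneq nxx => <-.
have z'x : z' != x by apply: contraNneq nxx => <-; rewrite adj_sym.
have zx : z != x by rewrite eq_sym irr.
have z'x' : z' != x' by rewrite eq_sym irr.
have bE w : (w \in ball v) = [|| w == v, w == x | w == x'].
  by rewrite in_ball -in_nbr Nv !inE.
have zb : z \notin ball v by rewrite bE !negb_or zv zx.
have z'b : z' \notin ball v by rewrite bE !negb_or z'v z'x.
have wT A : wgt A = 4 * #|A| by apply: wgt_full => w _; rewrite card_nbr2.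
have [ez|nz] := eqVneq z z'.
  have Nz : nbr z = [set x; x'] by apply: nbr_pair; rewrite // adj_sym // ez.
  have i1 : iso [set: G] <= 1.
    apply: (@iso_ball _ _ v); rewrite setTD; apply: thin_le2.
    apply: (@leq_trans #|[set z]|); last by rewrite cards1.
    have AT : z |: ball v = setT.
      apply: (@conn_full z); first exact: setU11.
      move=> a b; rewrite !in_setU1 !bE => /or4P[]/eqP->; rewrite -in_nbr ?Nz ?Nv ?Nx ?Nx' -?ez;
      by move=> /set2P[]->; rewrite eqxx ?orbT.
    apply/subset_leq_card/subsetP => w; rewrite in_setC => wb.
    by have := in_setT w; rewrite -AT in_setU1 (negbTE wb) orbF in_set1.
  have := subset_leq_card (subsetT (z |: ball v)); rewrite cardsU1 zb card_ball card_nbr2.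
  move: badG i1; rewrite /bad wT; move: (iso _) #|[set: G]| => i c; clear; lia.
pose W := ~: ball v; have [zW z'W] : z \in W /\ z' \in W by rewrite !in_setC.
have vb : v \in ball v by rewrite bE eqxx.
(* [a] loses one of its two neighbours, so it becomes a leaf inside [W]. *)
have oneW a b : adj a b -> a \in W -> b \in ball v -> (forall c, c \in ball v -> adj a c -> c = b) ->
    #|nbr a :&: W| = 1.
  move=> ab aW bb only; have [c Na cb] := nbr_other ab (n1 a).
  have cW : c \in W.
    rewrite in_setC; apply: contra cb => cb; apply/eqP/only => //.
    by rewrite -in_nbr Na set22.
  have -> : nbr a :&: W = [set c]; last by rewrite cards1.
  apply/setP => w; rewrite in_setI Na in_set1; apply/andP/eqP => [[/set2P[]->//]|->].
    by rewrite in_setC bb.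
  by rewrite set22.
have z1 : #|nbr z :&: W| = 1.
  apply: (oneW z x); rewrite 1?adj_sym // ?bE ?eqxx ?orbT //.
  move=> c; rewrite bE adj_sym -in_nbr => /or3P[]/eqP-> //; rewrite ?Nv ?Nx' => /set2P[] e.
  - by rewrite e eqxx in zx.
  - by rewrite e eqxx in zx'.
  - by rewrite e eqxx in zv.
  by rewrite e eqxx in nz.
have z'1 : #|nbr z' :&: W| = 1.
  apply: (oneW z' x'); rewrite 1?adj_sym // ?bE ?eqxx ?orbT //.
  move=> c; rewrite bE adj_sym -in_nbr => /or3P[]/eqP-> //; rewrite ?Nv ?Nx => /set2P[] e.
  - by rewrite e eqxx in z'x.
  - by rewrite e eqxx in z'x'.
  - by rewrite e eqxx in z'v.
  by rewrite e eqxx in nz.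
have linkW a b : a \in W -> b \in ball v -> adj b a -> (a == z) || (a == z').
  rewrite in_setC !bE !negb_or => /and3P[av ax ax'] /or3P[]/eqP->; rewrite -in_nbr ?Nv ?Nx ?Nx'.
  - by move=> /set2P[] e; rewrite e eqxx in ax ax'.
  - by move=> /set2P[] e; rewrite e eqxx // in av *.
  by move=> /set2P[] e; rewrite e eqxx ?orbT // in av *.
have noexc C : C \in comps W -> ~ exceptional_set C.
  rewrite inE => CC; have [cC sC clC] := compP _ _ CC.
  have vC : v \notin C by apply: contraL vb => /(subsetP sC); rewrite in_setC.
  case=> [C3|[u L]|[p pH [u L]]].
  - have [a [m [b [CE ab ma mb]]]] := conn3 cC C3; have Nm := nbr_pair ma mb ab.
    have [aC bC] : a \in C /\ b \in C by rewrite CE !inE !eqxx !orbT.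
    have [am bm] : adj a m /\ adj b m by rewrite ![adj _ m]adj_sym.
    have [a' Na am'] := nbr_other am (n1 a); have [b' Nb bm'] := nbr_other bm (n1 b).
    have nab : ~~ adj a b.
      apply/negP => aab; have aba : adj b a by rewrite adj_sym.
      have Ea := nbr_pair am aab (irr _ _ mb); have Eb := nbr_pair bm aba (irr _ _ ma).
      apply: (@small_closed C a) => //; first by rewrite C3.
      move=> c d; rewrite {1}CE => /set3P[]->; rewrite -in_nbr ?Ea ?Nm ?Eb => /set2P[]->;
      by rewrite CE !inE eqxx ?orbT.
    have outC c c' : c \in C -> adj c c' -> c' \notin C -> (c == z) || (c == z').
      move=> cC' cc' c'C; apply: (linkW c c'); [exact: (subsetP sC)| |by rewrite adj_sym].
      by apply: contraNT c'C => c'W; apply: (clC c); rewrite // in_setC.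
    have aa' : adj a a' by rewrite -in_nbr Na set22.
    have bb' : adj b b' by rewrite -in_nbr Nb set22.
    have a'C : a' \notin C.
      rewrite CE; apply/negP => /set3P[] e; rewrite e ?eqxx ?adj_irrefl // in aa' am' nab.
      by rewrite aa' in nab.
    have b'C : b' \notin C.
      rewrite CE; apply/negP => /set3P[] e; rewrite e ?eqxx ?adj_irrefl // in bb' bm' nab.
      by rewrite adj_sym bb' in nab.
    have [az bz] := (outC _ _ aC aa' a'C, outC _ _ bC bb' b'C).
    have [mz mz'] : adj m z /\ adj m z'.
      move: ma mb ab; case/orP: az => /eqP->; case/orP: bz => /eqP->; rewrite ?eqxx //.
    have Nz : nbr z = [set x; m].
      apply: nbr_pair; rewrite 1?adj_sym //; apply: contraNneq nxx => e.
      have mC : m \in C by rewrite CE !inE eqxx orbT.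
      by have := subsetP sC _ mC; rewrite in_setC -e bE eqxx orbT.
    have mW : m \in W by apply: (subsetP sC); rewrite CE !inE eqxx orbT.
    have Nz' : nbr z' = [set m; x'].
      apply: nbr_pair; rewrite 1?adj_sym //; apply: contraTneq mW => ->.
      by rewrite in_setC bE eqxx !orbT.
    have Nm' : nbr m = [set z; z'] by apply: nbr_pair.
    pose us := [:: v; x; z; m; z'; x'].
    have mv w : w \in ball v -> w != m by move=> wb; apply: contraTneq mW => <-; rewrite in_setC wb.
    have uus : uniq us.
      do ![rewrite /= ?inE ?negb_or]; do ![apply/andP; split];
      first [done | exact: irr | by rewrite eq_sym | by rewrite eq_sym irr | by rewrite mv // bE eqxx ?orbT
        | by rewrite eq_sym mv // bE eqxx ?orbT].
    have usT w : (w \in [set: G]) = (w \in us).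
      have <- : [set w in us] = setT; last by rewrite inE.
      apply: (@conn_full v); first by rewrite !inE eqxx.
      have inU (t : G) : t \in us ->
          [\/ t = v, t = x | t = z] \/ [\/ t = m, t = z' | t = x'].
        rewrite !inE; case/or4P=> [/eqP e|/eqP e|/eqP e|/or3P[]/eqP e];
        by [left; apply: Or31|left; apply: Or32|left; apply: Or33
           |right; apply: Or31|right; apply: Or32|right; apply: Or33].
      move=> a0 b0; rewrite 2!in_set => /inU[][]-> ; rewrite -in_nbr ?Nv ?Nx ?Nz ?Nm' ?Nz' ?Nx';
      by move=> /set2P[]->; rewrite !inE eqxx ?orbT.
    apply: nexcG; apply: Or33; exists (6, hex_edges) => //.
    apply: (@hex_copy _ v _ us) => // i i6.
    case: i i6 => [|[|[|[|[|[|?]]]]]] // _; rewrite /= ?Nv ?Nx ?Nz ?Nm' ?Nz' ?Nx' //; exact: setUC.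
  - suff : 3 <= #|nbr (u 0)| by rewrite card_nbr2.
    have [inj inC ad] := L; apply: (@uniq_leq_card _ [:: u 1; u 2; u 3]).
      rewrite -[[:: _; _; _]]/[seq u i | i <- [:: 1; 2; 3]] map_inj_in_uniq //.
      move=> i j iL jL; apply: inj; [move: iL|move: jL]; by rewrite !inE => /or3P[]/eqP->.
    by move=> w; rewrite !inE => /or3P[]/eqP->; rewrite ad.
  have [inj inC ad] := L; have [p7|p6] := eqVneq p.1 7.
    suff : 3 <= #|nbr (u 0)| by rewrite card_nbr2.
    apply: (@uniq_leq_card _ [:: u 1; u 5; u 6]).
      rewrite -[[:: _; _; _]]/[seq u i | i <- [:: 1; 5; 6]] map_inj_in_uniq //.
      move=> i j iL jL; apply: inj; rewrite p7; [move: iL|move: jL];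
      by rewrite !inE => /or3P[]/eqP->.
    move=> w; move: pH p7 ad; rewrite !inE => /or3P[]/eqP-> //= _ ad /or3P[]/eqP->; by rewrite ad.
  have hC : is_copy 6 hex_edges C.
    by move: pH p6 L; rewrite !inE => /or3P[]/eqP-> //= _ L; exists u.
  have [c cC'] := conn_n0 cC; have CT : C = setT.
    apply: (conn_full cC') => a b aC ab.
    suff : nbr a :&: C = nbr a by move/setP/(_ b); rewrite in_setI in_nbr ab.
    by apply/eqP; rewrite eqEcard subsetIl card_nbr2 (hex_reg hC aC).
  by rewrite CT in_setT in vC.
have le1 : iso [set: G] <= 1 + \sum_(C in comps W) iso C.
  have seal : sealed [set v] (ball v) := sealed_ball (subxx (ball v)).
  apply: leq_trans (iso_sealed seal) _; rewrite cards1 leq_add2l.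
  by apply: leq_sum => C _; apply/isoS/subsetDl.
have le2 : \sum_(C in comps W) 14 * iso C <= \sum_(C in comps W) wgt_in C.
  apply: leq_sum => C CW; have := CW; rewrite inE => CC; have [cC _ _] := compP _ _ CC.
  by case: (IH (comp_neqT CC vb) cC) => // /(noexc _ CW).
have le3 : \sum_(C in comps W) wgt_in C = \sum_(w in W) (4 - (#|nbr w :&: W| == 1)).
  rewrite (set_partition_big _ (comps_partition W)); apply: eq_bigr => C.
  rewrite inE => /compP[cC sC clC]; apply: eq_bigr => w wC; congr (4 - (#|pred_of_set _| == 1)).
  apply/setP => t; rewrite !in_setI in_nbr; apply/andP/andP => -[wt tC]; split=> //.
    exact: (subsetP sC).
  exact: (clC w).
have le4 : \sum_(w in W) (4 - (#|nbr w :&: W| == 1)) + 2 <= 4 * #|W|.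
  rewrite (big_setD1 z) //= (big_setD1 z') /=; last by rewrite in_setD1 eq_sym nz.
  rewrite z1 z'1; have := cardsD1 z W; have := cardsD1 z' (W :\ z).
  rewrite in_setD1 [z' == z]eq_sym nz z'W zW.
  have : \sum_(w in W :\ z :\ z') (4 - (#|nbr w :&: W| == 1)) <= 4 * #|W :\ z :\ z'|.
    by rewrite mulnC -sum_nat_const; apply: leq_sum => w _; apply: leq_subr.
  by move: (\sum_(_ in _) _) #|W :\ z :\ z'| #|W :\ z| #|W| => s a b c; clear; lia.
have dist : \sum_(C in comps W) 14 * iso C = 14 * \sum_(C in comps W) iso C.
  by rewrite big_distrr.
move: badG; rewrite /bad wT; have := cardsC (ball v); rewrite -/W card_ball card_nbr2 cardsT.
rewrite dist in le2; rewrite le3 in le2; move: le1 le2 le4.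
move: (\sum_(C in comps W) iso C) (\sum_(w in W) _) (iso _) #|G| #|W| => a b c d e.
by clear; lia.
Qed.

End Minimal.


(** * The weight bound *)

Lemma weight_bound (G : sgraph) : conn [set: G] -> ~ exceptional_set [set: G] ->
  14 * iso [set: G] <= wgt [set: G].
Proof.
have [n] := ubnP #|G|; elim: n G => // n IHn G /ltnSE-Gn cG nexc.
rewrite leqNgt; apply/negP => badG; apply: (no_minimal_counterexample cG _ nexc badG).
move=> C nT cC; have [exC|nexC] := pselect (exceptional_set C); [by left|right].
have lt : #|delete (~: C)| < n.
  by rewrite card_delete (leq_trans _ Gn) // -cardsT proper_card // properT.
apply: leq_trans (leq_mul (leqnn 14) (iso_delete C)) _; rewrite -wgt_in_delete.
by apply: IHn lt (conn_delete cC) _ => /exceptional_delete.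
Qed.

(** * From vertex sets back to isomorphisms *)

Lemma conn_connected (G : sgraph) : connected G -> conn [set: G].
Proof.
case/andP=> /card_gt0P[x0 _] /forallP cG; apply/connP; split.
  by apply/set0Pn; exists x0.
move=> A x xA _ clA; apply/subsetP => y _.
have clE : closed (@adj G) A.
  move=> a b ab; apply/idP/idP => [aA|bA]; first exact: (clA a).
  by apply: (clA b); rewrite // adj_sym.
by rewrite -(closed_connect clE (forallP (cG x) y)).
Qed.

Lemma copy_isomorphic (G : sgraph) k s : is_copy k s [set: G] -> isomorphic G (of_edges k s).
Proof.
case=> u L; have [inj inT ad] := L; pose g (i : 'I_k) := u i.
have injg : injective g by move=> i j /inj e; apply/val_inj/e.
have [f gK fK] : bijective g.
  by apply: (inj_card_bij injg); rewrite card_ord -(labels_card L) cardsT.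
exists f; first by exists g.
by move=> x y; rewrite -[in RHS](fK x) -[in RHS](fK y) /g ad.
Qed.

Lemma exceptional_isomorphic (G : sgraph) : conn [set: G] ->
  exceptional_set [set: G] -> exceptional G.
Proof.
move=> cG [G3|/copy_isomorphic|[p pH]].
- have [a [m [b [E ab ma mb]]]] := conn3 cG G3.
  have nE (x y : G) : adj x y -> x != y by apply: contraTneq => ->; rewrite adj_irrefl.
  have us : uniq [:: a; m; b] by rewrite /= !inE negb_or ab [a == m]eq_sym !nE.
  have inT z : (z \in [set: G]) = (z \in [:: a; m; b]) by rewrite E !inE orbA.
  have am : adj a m by rewrite adj_sym.
  have [aab|nab] := boolP (adj a b).
    right; left.
    have [|f bf ad] := @copy_isomorphic G 3 [:: (1, 2); (2, 3); (1, 3)].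
      apply: (copy_seq (x0 := a) us inT) => i j.
      by case: j => [|[|[|j]]]; case: i => [|[|[|i]]] // _ _; rewrite /= ?am ?mb ?aab.
    exists f => // x y; rewrite -ad; move: (f x) (f y).
    by do 2![case=> [[|[|[|?]]] ?] //].
  left; apply: copy_isomorphic; apply: (copy_seq (x0 := a) us inT) => i j.
  by case: j => [|[|[|j]]]; case: i => [|[|[|i]]] // _ _; rewrite /= ?am ?mb ?(negbTE nab).
- by right; right; left.
by move: pH; rewrite !inE => /or3P[]/eqP-> /copy_isomorphic H; do 3!right; [left|right; left|right; right].
Qed.

Lemma wgt_leaves (G : sgraph) : wgt [set: G] + #|leaves G| = 4 * #|G|.
Proof.
have -> : wgt [set: G] = \sum_(x : G) wt x by apply: eq_bigl => x; rewrite in_setT.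
have -> : #|leaves G| = \sum_(x : G) (x \in leaves G).
  by rewrite -sum1_card big_mkcond; apply: eq_bigr => x _; case: ifP.
rewrite -big_split /= mulnC -sum_nat_const; apply: eq_bigr => x _.
by rewrite /wt inE -/(nbr x); case: (_ == 1).
Qed.

Lemma path3_connected : connected (path_graph 3).
Proof.
apply/andP; split; first by rewrite card_ord.
pose m := Ordinal (isT : 1 < 3) : path_graph 3.
have to_m (x : path_graph 3) : connect (@adj (path_graph 3)) x m.
  case: x => [[|[|[|?]]] i] //; first exact: connect1.
    by rewrite (_ : Ordinal i = m) ?connect0 //; apply: val_inj.
  exact: connect1.
apply/forallP => x; apply/forallP => y; apply: connect_trans (to_m x) _.
rewrite (sym_connect_sym (@adj_sym _)); exact: to_m.
Qed.

Lemma path3_edges : 2 <= #|edges (path_graph 3)|.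
Proof.
pose o k (h : k < 3) : path_graph 3 := Ordinal h.
pose x := o 0 isT; pose y := o 1 isT; pose z := o 2 isT.
apply/card_gt1P; exists [set x; y], [set y; z]; split.
- by apply/imsetP; exists (x, y); rewrite ?inE.
- by apply/imsetP; exists (y, z); rewrite ?inE.
by apply/eqP => /setP/(_ x); rewrite !inE.
Qed.

(** A connected graph with two edges has a vertex with two neighbours, and such a vertex
    is the centre of a [path_graph 3], which has two edges. *)
Lemma isolating_thin (G : sgraph) (D : {set G}) :
  isolating 2 D <-> thin (~: closed_nbhd D).
Proof.
split=> [isoD|/thinP tD F [/andP[_ /forallP cF] F2] [f injf homf]].
  apply/thinP => x y z; rewrite !in_setC => xD yD zD xy xz.
  apply/eqP/negPn/negP => yz.
  have xny : x != y by apply: contraTneq xy => ->; rewrite adj_irrefl.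
  have xnz : x != z by apply: contraTneq xz => ->; rewrite adj_irrefl.
  pose d (w : G) (h : w \notin closed_nbhd D) : delete (closed_nbhd D) := exist _ w h.
  pose f (i : path_graph 3) := nth (d x xD) [:: d y yD; d x xD; d z zD] i.
  case: (isoD (path_graph 3)); first by split; [exact: path3_connected|exact: path3_edges].
  exists f.
    apply: (@can_inj _ _ _ (fun w => if val w == y then Ordinal (isT : 0 < 3) else
       if val w == x then Ordinal (isT : 1 < 3) else Ordinal (isT : 2 < 3))).
    case=> [[|[|[|?]]] ?] //=; apply: val_inj; rewrite /= ?eqxx ?(negbTE xny) //.
    by rewrite ![z == _]eq_sym (negbTE yz) (negbTE xnz).
  by do 2![case=> [[|[|[|?]]] ?] //] => _; rewrite /adj /= // adj_sym.
have one a b c : adj a b -> adj a c -> b = c :> F.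
  move=> ab ac; apply/injf/val_inj.
  have out w : val (f w) \in ~: closed_nbhd D by rewrite in_setC; apply: (svalP (f w)).
  exact: (tD (val (f a))) (out _) (out _) (out _) (homf _ _ ab) (homf _ _ ac).
have /card_gt1P[E1 [E2 [/imsetP[[a b] + ->] /imsetP[[c d] + ->]]]] := F2.
rewrite !inE /= => ab cd; have ba : adj b a by rewrite adj_sym.
have clE : closed (@adj F) [set a; b].
  apply: intro_closed; first by apply: sym_connect_sym; apply: adj_sym.
  move=> u w uw; rewrite !inE => /orP[]/eqP eu; rewrite eu in uw.
    by rewrite (one _ _ _ uw ab) eqxx orbT.
  by rewrite (one _ _ _ uw ba) eqxx.
have := closed_connect clE (forallP (cF a) c); rewrite !inE eqxx /=.
move=> /esym/orP[]/eqP ec; rewrite ec in cd *.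
  by rewrite (one _ _ _ cd ab) eqxx.
by rewrite (one _ _ _ cd ba) setUC eqxx.
Qed.

Lemma isolation_number_le (G : sgraph) : isolation_number 2 G <= iso [set: G].
Proof.
have [D tD <-] := isoP [set: G]; apply: (isolation_numberP 2 G).2.
by apply/isolating_thin; rewrite -setTD.
Qed.

(** * The extremal graphs *)

(** The closed neighbourhood of the [i]-th copy of [P_3] consists of that copy and of
    the [i]-th vertex of the path; [foot] sends it to [i].  An isolating set must meet
    all these neighbourhoods, which are disjoint. *)
Lemma BP3_lower (G : sgraph) (a b : nat) : isomorphic G (of_rel (@BP3_rel a b)) ->
  a <= isolation_number 2 G /\ 2 * a <= #|leaves G|.
Proof.
case=> f [g gK fK] ad.
have adg x p : adj (g p) x = adj p (f x) by rewrite -ad fK.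
pose foot (p : of_rel (@BP3_rel a b)) : nat :=
  match p with inl u => u | inr q => q.1 end.
pose w i k : of_rel (@BP3_rel a b) := inr (i, k).
have footE i k p : adj (w i k) p -> foot p = i.
  rewrite /adj /=; case: p => [u|[j l]] /=; first by case/andP=> /eqP[].
  by case/andP=> _; case/orP=> /andP[/eqP-> _].
have adjw i j k l : adj (w i k) (w j l) = (i == j) && ((k == 1 :> nat) != (l == 1 :> nat)).
  rewrite /w /adj /= [j == i]eq_sym; have [->|nij] := eqVneq i j; last by rewrite /= !andbF.
  case: k l => [[|[|[|?]]] ?] // [[|[|[|?]]] ?] //; rewrite ?andbF //=;
  by rewrite -[_ == _]/((_ == _) && false) andbF.
split.
  have [[D isoD <-] _] := isolation_numberP 2 G.
  rewrite -(size_iota 0 a) cardE -(size_map (fun d => foot (f d))).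
  apply: uniq_leq_size; first exact: iota_uniq.
  move=> i; rewrite mem_iota add0n => /= ia; apply/mapP.
  have [/exists_inP[d dD /eqP di]|none] := boolP [exists d in D, foot (f d) == i].
    by exists d; rewrite ?mem_enum.
  exfalso; pose q := w (Ordinal ia).
  have out k : g (q k) \in ~: closed_nbhd D.
    rewrite in_setC; apply/negP => /closedP[d dD]; rewrite in_ball => dk.
    case/negP: none; apply/exists_inP; exists d => //; apply/eqP.
    case/orP: dk => [/eqP <-|]; first by rewrite fK.
    by rewrite adj_sym adg => /footE->.
  have /isolating_thin/thinP := isoD.
  pose o k (h : k < 3) : 'I_3 := Ordinal h.
  move=> /(_ (g (q (o 1 isT))) (g (q (o 0 isT))) (g (q (o 2 isT)))).
  move=> /(_ (out _) (out _) (out _)); rewrite !adg !fK => H.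
  by move: H; rewrite !adjw eqxx => /(_ isT isT)/(can_inj fK); case.
pose o k (h : k < 3) : 'I_3 := Ordinal h.
pose h (p : 'I_a * bool) : G := g (w p.1 (if p.2 then o 0 isT else o 2 isT)).
have injh : injective h.
  by move=> [i c] [j c'] /(can_inj fK); case: c c' => [] [] // [->].
apply: leq_trans (_ : #|[set h p | p in [set: 'I_a * bool]]| <= _).
  by rewrite card_imset // cardsT card_prod card_ord card_bool mulnC.
apply/subset_leq_card/subsetP => x /imsetP[[i c] _ ->]; rewrite inE.
apply/cards1P; exists (g (w i (o 1 isT))); apply/setP => y; rewrite !inE adg.
rewrite -(can_eq gK) fK; case: (f y) => [u|[j l]]; first by case: c; rewrite /adj /= andbF.
rewrite -[inr (j, l)]/(w j l) adjw; case: c l => [] [[|[|[|?]]] ?] //=;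
  by rewrite ?andbF ?andbT.
Qed.

Theorem theorem3 (G : sgraph) (n : nat) (hconn : connected G) (hn : #|G| = n)
    (hS : ~ exceptional G) :
  isolation_number 2 G <= (4 * n - #|leaves G|) %/ 14 /\
  (isomorphic G (BP3 n) ->
   isolation_number 2 G = (4 * n - #|leaves G|) %/ 14).
Proof.
have cG := conn_connected hconn.
have bound : isolation_number 2 G <= (4 * n - #|leaves G|) %/ 14.
  rewrite leq_divRL // mulnC -hn -wgt_leaves addnK.
  apply: leq_trans (leq_mul (leqnn 14) (isolation_number_le G)) _.
  by apply: weight_bound => // /(exceptional_isomorphic cG).
split=> // isoB; apply/eqP; rewrite eqn_leq bound /=.
have n0 : 0 < n by rewrite -hn; case/andP: hconn.
have [n3|n4] := leqP n 3.
  have [n2|n2] := leqP n 2; first by rewrite divn_small //; move: n2; clear; lia.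
  case: hS; left; have en : n = 3 by apply/eqP; rewrite eqn_leq n3.
  by move: isoB; rewrite en.
move: isoB; rewrite /BP3 leqNgt n4 /= => /BP3_lower[lo le].
apply: leq_trans lo; rewrite -ltnS ltn_divLR //.
have := divn_eq n 4; have := ltn_pmod n (isT : 0 < 4).
by move: (n %/ 4) (n %% 4) le => a s; move: #|leaves G| => l; clear; lia.
Qed.
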